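(* Let $\mathbb{H}$ be a complex Hilbert space and let $T\in\mathbb{B}(\mathbb{H})$. Then $$\begin{aligned}\frac12\|T\|&\le\omega\left(\begin{bmatrix}O&\Re T\\ \Im T&O\end{bmatrix}\right)\\&\le\frac{\sqrt2}{2}\|(\Re T,\Im T)\|_e\\&\le\frac{\sqrt2}{2}\,\omega\left(|\Re T|+\mathrm{i}|\Im T|\right)\\&\le\frac{\sqrt2}{2}\left\|(\Re T)^2+(\Im T)^2\right\|^{1/2}\\&\le\frac{\sqrt2}{2}\sqrt{\|\Re T\|^2+\|\Im T\|^2}\\&\le\omega(T).\end{aligned}$$
   Context: $\mathbb{B}(\mathbb{H})$ is the algebra of bounded linear operators on $\mathbb{H}$, $\|\cdot\|$ is the operator norm, $O$ is the zero operator, $|T|=(T^*T)^{1/2}$, and $\mathrm{i}$ is the imaginary unit. $\Re T=\frac{T+T^*}{2}$ and $\Im T=\frac{T-T^*}{2\mathrm{i}}$. $\omega(T)=\sup_{\|x\|=1}|\langle Tx,x\rangle|$ is the numerical radius; the $2\times2$ operator matrix acts on the Hilbert space direct sum $\mathbb{H}\oplus\mathbb{H}$ and its numerical radius is taken there. The Euclidean operator norm of a pair is $\|(A,B)\|_e=\sup\{\|\lambda_1A+\lambda_2B\|:\lambda_1,\lambda_2\in\mathbb{C},\ |\lambda_1|^2+|\lambda_2|^2\le 1\}$; equivalently (known), $\|(A,B)\|_e=\sup_{\|x\|=\|y\|=1}\left(|\langle Ax,y\rangle|^2+|\langle Bx,y\rangle|^2\right)^{1/2}$. *)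

(* Defs.v *)
From HB Require Import structures.
From mathcomp Require Import all_boot all_order all_algebra.
From mathcomp Require Import complex ring.
From mathcomp Require Import all_classical all_reals all_analysis.

Set Implicit Arguments.
Unset Strict Implicit.
Unset Printing Implicit Defensive.

Import Order.TTheory GRing.Theory Num.Theory.
Import numFieldNormedType.Exports.

Local Open Scope classical_set_scope.
Local Open Scope ring_scope.
Local Open Scope complex_scope.

(* Inner products are linear in the first argument and conjugate-linear in the
   second one.  As H is a module over R[i], its norm has values in R[i]. *)
HB.mixin Record NormedModule_isInnerProduct (R : realType) H
    & NormedModule R[i] H := {
  inner : {dot H for @Num.conj R[i]};
  innerxx : forall x, inner x x = `|x| ^+ 2
}.

#[short(type="innerProductType")]
HB.structure Definition InnerProduct (R : realType) :=
  {H of NormedModule R[i] H & NormedModule_isInnerProduct R H}.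

#[short(type="hilbertType")]
HB.structure Definition Hilbert (R : realType) :=
  {H of InnerProduct R H & Complete H}.

Lemma sqrtC_minkowski (C : numClosedFieldType) (a b c d : C) :
  0 <= a -> 0 <= b -> 0 <= c -> 0 <= d ->
  sqrtC ((a + c) ^+ 2 + (b + d) ^+ 2) <=
  sqrtC (a ^+ 2 + b ^+ 2) + sqrtC (c ^+ 2 + d ^+ 2).
Proof.
move=> a0 b0 c0 d0.
have sqr_ge0 (x y : C) : 0 <= x -> 0 <= y -> 0 <= x ^+ 2 + y ^+ 2.
  by move=> x0 y0; rewrite addr_ge0 ?exprn_ge0.
have ac0 := addr_ge0 a0 c0; have bd0 := addr_ge0 b0 d0.
have p0 := sqr_ge0 _ _ a0 b0; have q0 := sqr_ge0 _ _ c0 d0.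
rewrite -(@ler_pXn2r _ 2) ?nnegrE ?addr_ge0 ?sqrtC_ge0 ?sqr_ge0//.
rewrite sqrtCK [leRHS]sqrrD !sqrtCK -sqrtCM ?nnegrE// -subr_ge0.
set s := sqrtC _.
have -> : a ^+ 2 + b ^+ 2 + s *+ 2 + (c ^+ 2 + d ^+ 2) -
    ((a + c) ^+ 2 + (b + d) ^+ 2) = (s - (a * c + b * d)) *+ 2 by ring.
have s0 : 0 <= s by rewrite sqrtC_ge0 mulr_ge0.
have m0 : 0 <= a * c + b * d by rewrite addr_ge0// mulr_ge0.
rewrite mulrn_wge0// subr_ge0 -(@ler_pXn2r _ 2) ?nnegrE//.
rewrite /s sqrtCK -subr_ge0.
have -> : (a ^+ 2 + b ^+ 2) * (c ^+ 2 + d ^+ 2) - (a * c + b * d) ^+ 2 =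
  (a * d - b * c) ^+ 2 by ring.
by rewrite real_exprn_even_ge0// realB// realM// ger0_real.
Qed.

(* The orthogonal direct sum.  The alias is needed because the library equips
   the product of two normed modules with the maximum norm. *)
Definition hsum (H1 H2 : Type) : Type := (H1 * H2)%type.

Section hsum_inner_product.
Variables (R : realType) (H1 H2 : innerProductType R).
Local Notation H := (hsum H1 H2).

HB.instance Definition _ := GRing.Lmodule.copy H (H1 * H2)%type.

Definition hsum_norm (u : H) : R[i] := sqrtC (`|u.1| ^+ 2 + `|u.2| ^+ 2).

Let normD (u v : H) : hsum_norm (u + v) <= hsum_norm u + hsum_norm v.
Proof.
apply: le_trans (sqrtC_minkowski _ _ _ _) => //.
rewrite ler_sqrtC ?nnegrE ?addr_ge0 ?exprn_ge0 ?addr_ge0//.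
by rewrite lerD// lerXn2r ?nnegrE ?addr_ge0// ler_normD.
Qed.

Let normZ (l : R[i]) (u : H) : hsum_norm (l *: u) = `|l| * hsum_norm u.
Proof.
rewrite /hsum_norm /= !normrZ !exprMn -mulrDr sqrtCM ?nnegrE ?exprn_ge0//.
  by rewrite sqrCK.
Qed.

Let norm0_eq0 (u : H) : hsum_norm u = 0 -> u = 0.
Proof.
move=> /eqP; rewrite sqrtC_eq0 paddr_eq0 ?exprn_ge0//.
rewrite !sqrf_eq0 !normr_eq0 => /andP[/eqP u1 /eqP u2].
by case: u u1 u2 => ? ? /= -> ->.
Qed.

HB.instance Definition _ :=
  @Lmodule_isNormed.Build R[i] H hsum_norm normD normZ norm0_eq0.

Definition hsum_inner (u v : H) : R[i] := inner u.1 v.1 + inner u.2 v.2.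

Let inner_bilinear :
  bilinear_for *%R (Num.conj \; *%R) hsum_inner.
Proof.
split=> [v|u] a x y; rewrite /hsum_inner /=.
  by rewrite !linearPl mulrDr addrACA.
by rewrite !linearPr /= mulrDr addrACA.
Qed.

HB.instance Definition _ := bilinear_isBilinear.Build R[i] H H R[i]
  *%R (Num.conj \; *%R) hsum_inner inner_bilinear.

Let inner_hermitian (u v : H) :
  hsum_inner u v = (-1) ^+ false * Num.conj (hsum_inner v u).
Proof.
by rewrite /hsum_inner rmorphD mulrDr -!hermC.
Qed.

HB.instance Definition _ := isHermitianSesquilinear.Build R[i] H false
  Num.conj hsum_inner inner_hermitian.

Let innerE (u : H) : hsum_inner u u = `|u| ^+ 2.
Proof. by rewrite [RHS]sqrtCK /hsum_inner !innerxx. Qed.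

Let inner_gt0 (u : H) : u != 0 -> 0 < hsum_inner u u.
Proof. by move=> u0; rewrite innerE exprn_gt0// normr_gt0. Qed.

HB.instance Definition _ := isDotProduct.Build R[i] H hsum_inner inner_gt0.

HB.instance Definition _ := NormedModule_isInnerProduct.Build R H innerE.

End hsum_inner_product.

Section hsum_hilbert.
Variables (R : realType) (H1 H2 : hilbertType R).
Local Notation H := (hsum H1 H2).

Let norm_fst (u : H) : `|u.1| <= `|u|.
Proof.
rewrite -(sqrCK (normr_ge0 u.1)) ler_sqrtC ?nnegrE ?addr_ge0 ?exprn_ge0//.
by rewrite lerDl exprn_ge0.
Qed.

Let norm_snd (u : H) : `|u.2| <= `|u|.
Proof.
rewrite -(sqrCK (normr_ge0 u.2)) ler_sqrtC ?nnegrE ?addr_ge0 ?exprn_ge0//.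
by rewrite lerDr exprn_ge0.
Qed.

Let norm_sum (u : H) : `|u| <= `|u.1| + `|u.2|.
Proof.
rewrite -[leRHS]sqrCK ?addr_ge0//.
rewrite ler_sqrtC ?nnegrE ?addr_ge0 ?exprn_ge0 ?addr_ge0//.
by rewrite sqrrD addrAC lerDl mulrn_wge0// mulr_ge0.
Qed.

Let hsum_complete (F : set_system H) : ProperFilter F -> cauchy F -> cvg F.
Proof.
move=> FF /cauchyP Fc.
have /cauchy_cvg/cvg_ex[x1 Fx1] : cauchy (fst @ F : set_system H1).
  apply/cauchy_exP => e /Fc[u Fu]; exists u.1.
  suff : F [set v | ball u.1 e v.1] by [].
  apply: (filterS _ Fu) => v /=; rewrite -!ball_normE /=.
  exact: (le_lt_trans (norm_fst (u - v))).
have /cauchy_cvg/cvg_ex[x2 Fx2] : cauchy (snd @ F : set_system H2).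
  apply/cauchy_exP => e /Fc[u Fu]; exists u.2.
  suff : F [set v | ball u.2 e v.2] by [].
  apply: (filterS _ Fu) => v /=; rewrite -!ball_normE /=.
  exact: (le_lt_trans (norm_snd (u - v))).
apply/cvg_ex; exists ((x1, x2) : H); apply/cvgrPdist_lt => e e0.
have e20 : 0 < e / 2 by rewrite divr_gt0.
move/cvgrPdist_lt : Fx1 => /(_ _ e20) Fx1.
move/cvgrPdist_lt : Fx2 => /(_ _ e20) Fx2.
apply: filterS2 Fx1 Fx2 => u u1 u2.
apply: le_lt_trans (norm_sum _) _.
by rewrite [ltRHS]splitr ltrD.
Qed.

HB.instance Definition _ := Uniform_isComplete.Build H hsum_complete.
HB.instance Definition _ := Hilbert.copy H H.
End hsum_hilbert.

Section operators.
Variables (R : realType) (H : hilbertType R).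
Implicit Types (f g A B P S : H -> H) (x y : H).

(* complex.Re only turns the R[i]-valued, but real, norm into an element of R.
   The suprema below are over nonempty bounded sets whenever the operators are
   bounded, except when H = 0, where the numerical radius is sup set0 = 0. *)
Definition opnorm f : R :=
  sup [set complex.Re `|f x| | x in [set x : H | `|x| <= 1]].

Definition numerical_radius f : R :=
  sup [set complex.Re `|inner (f x) x| | x in [set x : H | `|x| = 1]].

Definition euclidean_opnorm A B : R :=
  sup [set opnorm (l.1 \*: A \+ l.2 \*: B) |
       l in [set l : R[i] * R[i] | `|l.1| ^+ 2 + `|l.2| ^+ 2 <= 1]].

(* Meaningful when f is linear and bounded: the adjoint then exists, and it is
   unique because the inner product is nondegenerate. *)
Definition adjoint f : H -> H :=
  xget \0 [set g | forall x y, inner (f x) y = inner x (g y)].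

Definition bounded_operator f :=
  linear f /\ bounded_near f (nbhs (0 : H)).

(* In R[i], 0 <= z also says that z is real. *)
Definition positive_operator P :=
  bounded_operator P /\ forall x, 0 <= inner (P x) x.

(* Meaningful when P is positive: its positive square root then exists and is
   unique. *)
Definition sqrt_operator P : H -> H :=
  xget \0 [set S | positive_operator S /\ S \o S = P].

Definition abs_operator f : H -> H := sqrt_operator (adjoint f \o f).

Definition Re_operator f : H -> H := 2^-1 \*: (f \+ adjoint f).

Definition Im_operator f : H -> H := (2 * 'i)^-1 \*: (f \- adjoint f).

End operators.

Definition block_operator (R : realType) (H : hilbertType R)
    (A B C D : H -> H) (u : hsum H H) : hsum H H :=
  (A u.1 + B u.2, C u.1 + D u.2).

(* Main.v *)
From HB Require Import structures.
Require Import Defs.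
From mathcomp Require Import all_boot all_order all_algebra.
From mathcomp Require Import complex ring lra.
From mathcomp Require Import all_classical all_reals all_analysis.
Import Order.TTheory GRing.Theory Num.Theory.
Import numFieldNormedType.Exports.
Local Open Scope ring_scope.

(** Write [A] and [B] for the real and imaginary parts of [T], which are
symmetric, so that [T = A + i B]; write [|A|], [|B|] for the positive square
roots of [A^2], [B^2], and [M] for the off-diagonal block operator.

- [||T|| / 2 <= w(M)] ([inner_le_off_diagonal]).  Evaluating the quadratic form
  of [M] at the vector with components [c y] and [x] gives
  [c^* <A x, y> + c <B x, y>^*].  Up to a unit factor, a suitable unit [c] turns
  its real part into [|<A x, y> + i <B x, y>| = |<T x, y>|].
- [w(M) <= sqrt 2 / 2 ||(A, B)||_e] ([off_diagonal_le_euclidean]).  The form of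
  [M] at [u] is bounded by [|<A u2, u1>| + |<B u2, u1>|], which is [sqrt 2]
  times [<(l A + m B) u2, u1>] where [l] and [m] are unit phases divided by
  [sqrt 2]; and [||u1|| ||u2|| <= 1/2] on the unit sphere.
- [||(A, B)||_e <= w(|A| + i |B|)] ([euclidean_le_abs]).  Apply the Schwarz
  inequality to the coefficients, then the mixed Schwarz inequality
  [|<A x, y>|^2 <= <|A| x, x> <|A| y, y>] ([mixed_schwarz]), then the Schwarz
  inequality in the plane.
- [w(|A| + i |B|) <= ||A^2 + B^2||^(1/2)] ([abs_le_sqrt]).  On unit vectors
  [<|A| x, x> <= || |A| x || = ||A x||].
- The last two bounds are the triangle inequality and the fact that the norm of
  a symmetric operator is the supremum of its quadratic form
  ([symmetric_norm]), together with [|<A x, x>| <= |<T x, x>|].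

Three existence questions lie below.  The adjoint comes from the Riesz
representation theorem ([riesz_real]).  The square root of a positive operator
is the norm limit of an explicit iteration ([sqrt_one_sub]).  The mixed Schwarz
inequality has to hold for whichever positive square root of [A^2] the
definition of the absolute value selects; instead of uniqueness of the root, it
rests on the inequality [-|A| <= A <= |A|], which holds for every positive root
([square_root_dominates]). *)

Set Implicit Arguments.
Unset Strict Implicit.
Unset Printing Implicit Defensive.
Local Open Scope classical_set_scope.
Local Open Scope complex_scope.

(** * Real-valued norm and real part of the inner product *)

Section real_norm.
Variable R : realType.

(** Norms over [R[i]] take their values in [R[i]]; estimates are carried out on
this real number instead. *)
Definition rnorm (V : normedZmodType R[i]) (x : V) : R := complex.Re `|x|.

Variable V : normedZmodType R[i].
Implicit Types x y : V.

Lemma rnormE x : `|x| = (rnorm x)%:C.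
Proof. by rewrite /rnorm RRe_real. Qed.

Lemma rnorm_ge0 x : 0 <= rnorm x.
Proof. by rewrite -ler0c -rnormE. Qed.

Lemma rnormD x y : rnorm (x + y) <= rnorm x + rnorm y.
Proof. by rewrite -lecR rmorphD /= -!rnormE ler_normD. Qed.

Lemma rnormBC x y : rnorm (x - y) = rnorm (y - x).
Proof. by rewrite /rnorm distrC. Qed.

Lemma rnorm0 : rnorm (0 : V) = 0.
Proof. by rewrite /rnorm normr0. Qed.

Lemma rnorm0_eq0 x : rnorm x = 0 -> x = 0.
Proof. by move=> x0; apply/eqP; rewrite -normr_eq0 rnormE x0. Qed.

End real_norm.

Section real_modulus.
Variable R : realType.
Implicit Types (a b : R[i]).

Lemma complexReD a b : complex.Re (a + b) = complex.Re a + complex.Re b.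
Proof. by case: a b => p q []. Qed.

Lemma rnormM a b : rnorm (a * b) = rnorm a * rnorm b.
Proof. by apply: complexI; rewrite rmorphM /= -!rnormE normrM. Qed.

Lemma rnormZ (W : normedModType R[i]) a (x : W) :
  rnorm (a *: x) = rnorm a * rnorm x.
Proof. by apply: complexI; rewrite rmorphM /= -!rnormE normrZ. Qed.

Lemma rnormC_sqr a : rnorm a ^+ 2 = complex.Re a ^+ 2 + complex.Im a ^+ 2.
Proof. by rewrite /rnorm normc_def sqr_sqrtr// addr_ge0// sqr_ge0. Qed.

Lemma Re_le_rnorm a : `|complex.Re a| <= rnorm a.
Proof. by rewrite -lecR -rnormE normc_ge_Re. Qed.

Lemma rnorm_real (r : R) : rnorm r%:C = `|r|.
Proof. by rewrite /rnorm normc_def /= expr0n addr0 sqrtr_sqr. Qed.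

Lemma unit_phase a :
  exists2 c : R[i], rnorm c = 1 & c * a = (rnorm a)%:C.
Proof.
have [->|a0] := eqVneq a 0.
  by exists 1; rewrite ?mulr0 /rnorm ?normr0 ?normr1.
exists (`|a| / a); last by rewrite mulfVK// rnormE.
by rewrite /rnorm normrM normrV ?unitfE// normr_id divff ?normr_eq0.
Qed.

End real_modulus.

Section inner.
Variables (R : realType) (H : innerProductType R).
Implicit Types (x y z : H) (a : R[i]).

Definition rip x y : R := complex.Re (inner x y).

Lemma inner_conj x y : inner y x = (inner x y)^*%C.
Proof. by rewrite hermC expr0 mul1r. Qed.

Lemma innerDl x y z : inner (x + y) z = inner x z + inner y z.
Proof. exact: linearDl. Qed.

Lemma innerDr x y z : inner z (x + y) = inner z x + inner z y.
Proof. exact: linearDr. Qed.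

Lemma innerNl x y : inner (- x) y = - inner x y.
Proof. exact: linearNl. Qed.

Lemma innerNr x y : inner x (- y) = - inner x y.
Proof. exact: linearNr. Qed.

Lemma innerZl a x y : inner (a *: x) y = a * inner x y.
Proof. exact: linearZl_LR. Qed.

Lemma innerZr a x y : inner x (a *: y) = a^*%C * inner x y.
Proof. exact: linearZr_LR. Qed.

Definition innerE := (innerDl, innerDr, innerNl, innerNr, innerZl, innerZr).

Lemma ripC x y : rip x y = rip y x.
Proof. by rewrite /rip inner_conj; case: (inner y x). Qed.

Lemma ripDl x y z : rip (x + y) z = rip x z + rip y z.
Proof. by rewrite /rip linearDl complexReD. Qed.

Lemma ripZl (r : R) x y : rip (r%:C *: x) y = r * rip x y.
Proof.
by rewrite /rip linearZl_LR /=; case: (inner x y) => p q /=; rewrite mul0r subr0.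
Qed.

Lemma ripNl x y : rip (- x) y = - rip x y.
Proof. by rewrite -scaleN1r -(rmorphN1 (real_complex R)) ripZl mulN1r. Qed.

Lemma ripDr x y z : rip z (x + y) = rip z x + rip z y.
Proof. by rewrite ripC ripDl !(ripC z). Qed.

Lemma ripZr (r : R) x y : rip x (r%:C *: y) = r * rip x y.
Proof. by rewrite ripC ripZl ripC. Qed.

Lemma ripNr x y : rip x (- y) = - rip x y.
Proof. by rewrite ripC ripNl ripC. Qed.

Lemma ripxx x : rip x x = rnorm x ^+ 2.
Proof. by rewrite /rip innerxx rnormE -rmorphXn. Qed.

Lemma rip_scale a x y :
  rip (a *: x) (a *: y) = rnorm a ^+ 2 * rip x y.
Proof.
rewrite /rip linearZl_LR linearZr_LR /= mulrCA mulrA.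
have -> : (conjc a * a) = (rnorm a ^+ 2)%:C.
  by rewrite mulrC -sqr_normc rnormE rmorphXn.
by case: (inner x y) => p q /=; rewrite mul0r subr0.
Qed.

Lemma rip_i x y : rip ('i *: x) y = - complex.Im (inner x y).
Proof.
by rewrite /rip linearZl_LR /=; case: (inner x y) => p q /=; ring.
Qed.

Definition ripE := (ripDl, ripDr, ripNl, ripNr, ripZl, ripZr).

Lemma normalize x : x != 0 ->
  exists2 u, rnorm u = 1 & x = (rnorm x)%:C *: u.
Proof.
move=> x0; have n0 : rnorm x != 0 by apply: contraNneq x0 => /rnorm0_eq0 ->.
exists ((rnorm x)^-1%:C *: x).
  by rewrite rnormZ rnorm_real normfV ger0_norm ?rnorm_ge0// mulVf.
by rewrite scalerA -rmorphM /= mulfV// scale1r.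
Qed.

Lemma rip0l x : rip 0 x = 0.
Proof. by rewrite -(scale0r (0 : H)) -(rmorph0 (real_complex R)) ripZl mul0r. Qed.

(** The imaginary part is recovered from the real part by replacing [x] with
[i x]. *)
Lemma inner_eq_rip x y x' y' :
  (forall a, rip (a *: x) y = rip (a *: x') y') -> inner x y = inner x' y'.
Proof.
move=> e; have := e 1; have := e 'i; rewrite !rip_i !scale1r /rip.
by case: (inner x y) => p q; case: (inner x' y') => p' q' /= /oppr_inj -> ->.
Qed.

End inner.

(** * Linear and symmetric operators *)

Section linear_maps.
Variables (R : realType) (H : innerProductType R).
Implicit Types (f g : H -> H) (x y : H) (a b : R[i]).

Lemma lin0 f (lf : linear f) : f 0 = 0.
Proof. by have := lf (-1) 0 0; rewrite !scaleN1r !addNr. Qed.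

Lemma linD f (lf : linear f) x y : f (x + y) = f x + f y.
Proof. by have := lf 1 x y; rewrite !scale1r. Qed.

Lemma linZ f (lf : linear f) a x : f (a *: x) = a *: f x.
Proof. by have := lf a x 0; rewrite (lin0 lf) !addr0. Qed.

Lemma linN f (lf : linear f) x : f (- x) = - f x.
Proof. by rewrite -scaleN1r (linZ lf) scaleN1r. Qed.

Lemma linB f (lf : linear f) x y : f (x - y) = f x - f y.
Proof. by rewrite (linD lf) (linN lf). Qed.

Lemma linear_id : linear (@id H).
Proof. by []. Qed.

Lemma linear_add f g : linear f -> linear g -> linear (fun x => f x + g x).
Proof. by move=> lf lg a x y; rewrite lf lg scalerDr addrACA. Qed.

Lemma linear_opp f : linear f -> linear (fun x => - f x).
Proof. by move=> lf a x y; rewrite lf opprD scalerN. Qed.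

Lemma linear_sub f g : linear f -> linear g -> linear (fun x => f x - g x).
Proof. by move=> lf /linear_opp; apply: linear_add. Qed.

Lemma linear_scale b f : linear f -> linear (fun x => b *: f x).
Proof. by move=> lf a x y; rewrite lf scalerDr !scalerA mulrC. Qed.

Lemma linear_comp f g : linear f -> linear g -> linear (fun x => f (g x)).
Proof. by move=> lf lg a x y; rewrite lg lf. Qed.

End linear_maps.

(** * Domination of quadratic forms *)

Section domination.
Variables (R : realType) (H : innerProductType R).
Implicit Types (A S D : H -> H) (x y : H).

(** The discriminant condition, in a form that also covers [a = 0] or [b = 0]:
the hypothesis at [s = c], [t = a] gives [a c^2 <= a (a b)], and symmetrically
for [b]. *)
Lemma quadratic_bound (a b c : R) : 0 <= a -> 0 <= b ->
  (forall s t, 2 * (s * t * c) <= s ^+ 2 * a + t ^+ 2 * b) -> c ^+ 2 <= a * b.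
Proof.
move=> a0 b0 q.
have [a1|a1] := ltP 0 a.
  by rewrite -(ler_pM2l a1); have := q c a; lra.
have [b1|b1] := ltP 0 b.
  by rewrite -(ler_pM2l b1); have := q b c; lra.
have [a_0 b_0] : a = 0 /\ b = 0 by lra.
by have := q c 1; rewrite a_0 b_0; lra.
Qed.

Definition symmetric_op A := forall x y, inner (A x) y = inner x (A y).

Lemma rip_sym A x y : symmetric_op A -> rip (A x) y = rip x (A y).
Proof. by rewrite /rip => ->. Qed.

(** By polarization, [4 s t <A x, y>] is the difference of the quadratic form
of [A] at [s x + t y] and [s x - t y], hence at most
[2 s^2 <S x, x> + 2 t^2 <S y, y>]; then use the discriminant.  The case
[A = S = id] is the Schwarz inequality. *)
Lemma domination A S : linear A -> linear S -> symmetric_op A ->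
    (forall x, `|rip (A x) x| <= rip (S x) x) ->
  forall x y, rnorm (inner (A x) y) ^+ 2 <= rip (S x) x * rip (S y) y.
Proof.
move=> lA lS sA AS x y.
have S0 z : 0 <= rip (S z) z := le_trans (normr_ge0 _) (AS z).
have re z : rip (A z) y ^+ 2 <= rip (S z) z * rip (S y) y.
  apply: quadratic_bound => // s t.
  have := AS (s%:C *: z + t%:C *: y); have := AS (s%:C *: z - t%:C *: y).
  rewrite !ler_norml !(linD lA, linD lS, linN lA, linN lS, linZ lA, linZ lS) !ripE.
  have -> : rip (A y) z = rip (A z) y by rewrite rip_sym// ripC.
  lra.
(* Rotating x by a unit scalar makes <A x, y> real and leaves <S x, x> fixed. *)
have [c c1 ce] := unit_phase (inner (A x) y).
have := re (c *: x); rewrite (linZ lA) (linZ lS) rip_scale c1 expr1n mul1r.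
by rewrite {1}/rip linearZl_LR /= ce.
Qed.

Lemma cauchy_schwarz x y : rnorm (inner x y) <= rnorm x * rnorm y.
Proof.
rewrite -(@ler_pXn2r _ 2) ?nnegrE ?mulr_ge0 ?rnorm_ge0// exprMn -!ripxx.
apply: (@domination id id) => // z.
by rewrite ger0_norm// ripxx sqr_ge0.
Qed.

Lemma rip_cauchy_schwarz x y : `|rip x y| <= rnorm x * rnorm y.
Proof. exact: le_trans (Re_le_rnorm _) (cauchy_schwarz x y). Qed.

Lemma symmetric_id : symmetric_op id.
Proof. by []. Qed.

Lemma symmetric_add A D :
  symmetric_op A -> symmetric_op D -> symmetric_op (fun x => A x + D x).
Proof. by move=> sA sD x y; rewrite !innerE sA sD. Qed.

Lemma symmetric_opp A : symmetric_op A -> symmetric_op (fun x => - A x).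
Proof. by move=> sA x y; rewrite !innerE sA. Qed.

Lemma symmetric_sub A D :
  symmetric_op A -> symmetric_op D -> symmetric_op (fun x => A x - D x).
Proof. by move=> sA /symmetric_opp; apply: symmetric_add. Qed.

Lemma symmetric_scale (r : R) A :
  symmetric_op A -> symmetric_op (fun x => r%:C *: A x).
Proof. by move=> sA x y; rewrite !innerE sA conjc_real. Qed.

(** Take [y = A x] in the lemma [domination] and divide by [||A x||^2]. *)
Lemma dominated_norm A S (L : R) : linear A -> linear S -> symmetric_op A ->
    (forall x, `|rip (A x) x| <= rip (S x) x) ->
    (forall x, rip (S x) x <= L * rnorm x ^+ 2) ->
  forall x, rnorm (A x) ^+ 2 <= L * rip (S x) x.
Proof.
move=> lA lS sA AS SL x; set n := rnorm (A x).
have S0 z : 0 <= rip (S z) z := le_trans (normr_ge0 _) (AS z).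
have [Ax0|Ax0] := eqVneq (A x) 0.
  rewrite /n Ax0 rnorm0 expr0n /=.
  have [->|x0] := eqVneq x 0; first by rewrite (lin0 lS) rip0l mulr0.
  have [u u1 _] := normalize x0.
  have : 0 <= L by have := le_trans (S0 u) (SL u); rewrite u1 expr1n mulr1.
  by move=> L0; rewrite mulr_ge0.
have n0 : 0 < n ^+ 2.
  by rewrite exprn_gt0// lt_def rnorm_ge0 andbT; apply: contra_neq Ax0 => /rnorm0_eq0.
rewrite -(ler_pM2r n0).
apply: le_trans (_ : rip (S x) x * rip (S (A x)) (A x) <= _); last first.
  by rewrite [L * _]mulrC -mulrA ler_wpM2l ?S0// SL.
apply: le_trans (domination lA lS sA AS x (A x)).
rewrite -expr2 lerXn2r ?nnegrE ?sqr_ge0 ?rnorm_ge0//.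
by rewrite -ripxx; apply: le_trans (Re_le_rnorm _); rewrite ler_norm.
Qed.

(** For a symmetric operator, a bound of the quadratic form bounds the norm:
it is dominated by [c] times the identity. *)
Lemma symmetric_norm A (c : R) : linear A -> symmetric_op A -> 0 <= c ->
    (forall x, `|rip (A x) x| <= c * rnorm x ^+ 2) ->
  forall x, rnorm (A x) <= c * rnorm x.
Proof.
move=> lA sA c0 Ac x.
have lc : linear (fun x : H => c%:C *: x).
  by apply: linear_scale; apply: linear_id.
rewrite -(@ler_pXn2r _ 2) ?nnegrE ?mulr_ge0 ?rnorm_ge0//.
have -> : (c * rnorm x) ^+ 2 = c * rip (c%:C *: x) x.
  by rewrite ripZl ripxx; ring.
by apply: (dominated_norm lA lc sA) => z; rewrite ripZl ripxx.
Qed.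

(** With [D = A - S], the equality [A^2 = S^2] reads
[||D x||^2 + 2 <D x, S x> = 0].  If the supremum [m] of the quadratic form of
[D] on the unit sphere were positive, then unit vectors [x] that nearly attain
it would satisfy [D x ~ m x], so [||D x||^2 + 2 m <S x, x> ~ 0], although
[||D x||] is close to [m] and [S] is positive. *)
Lemma square_root_upper_bound A S (K : R) : linear A -> linear S ->
    symmetric_op A -> symmetric_op S -> 0 <= K ->
    (forall x, rnorm (A x) <= K * rnorm x) ->
    (forall x, rnorm (S x) <= K * rnorm x) ->
    (forall x, 0 <= rip (S x) x) -> (forall x, A (A x) = S (S x)) ->
  forall x, rip (A x) x <= rip (S x) x.
Proof.
move=> lA lS sA sS K0 AK SK S0 AS x0; rewrite leNgt; apply/negP => lt0.
pose D x := A x - S x.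
have lD : linear D by apply: linear_sub.
have sD : symmetric_op D by apply: symmetric_sub.
have DK x : rnorm (D x) <= 2 * K * rnorm x.
  rewrite /D; apply: le_trans (rnormD _ _) _.
  rewrite -(sub0r (S x)) rnormBC subr0.
  have := AK x; have := SK x; lra.
have absDK x : `|rip (D x) x| <= 2 * K * rnorm x ^+ 2.
  apply: le_trans (rip_cauchy_schwarz _ _) _.
  by rewrite expr2 mulrA ler_wpM2r ?rnorm_ge0.
pose E := [set rip (D x) x | x in [set x : H | rnorm x = 1]].
have ubE : ubound E (2 * K).
  move=> _ [x /= x1 <-]; apply: le_trans (ler_norm _) _.
  by have := absDK x; rewrite x1 expr1n mulr1.
have [d0 Ed0 d0_gt0] : exists2 d, E d & 0 < d.
  have x0n : x0 != 0.
    by apply: contraPneq lt0 => ->; rewrite (lin0 lA) (lin0 lS) ltxx.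
  have [u u1 x0E] := normalize x0n.
  exists (rip (D u) u); first by exists u.
  have : 0 < rip (D x0) x0 by rewrite /D !ripE subr_gt0.
  rewrite x0E (linZ lD) rip_scale pmulr_rgt0//.
  rewrite exprn_gt0// rnorm_real normr_gt0.
  by apply: contra_neq x0n => /rnorm0_eq0.
have supE : has_sup E by split; [exists d0|exists (2 * K)].
pose m := sup E.
have m_gt0 : 0 < m by apply: lt_le_trans d0_gt0 _; apply: sup_upper_bound.
have Em x : rip (D x) x <= m * rnorm x ^+ 2.
  have [->|x_n0] := eqVneq x 0.
    by rewrite (lin0 lD) rip0l rnorm0 expr0n mulr0.
  have [u u1 xE] := normalize x_n0.
  rewrite {1 2}xE (linZ lD) rip_scale rnorm_real mulrC.
  rewrite ger0_norm ?rnorm_ge0// ler_wpM2r ?sqr_ge0//.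
  by apply: sup_upper_bound => //; exists u.
(* F = m - D is positive, so ||F x||^2 is controlled by <F x, x>: this is what
   makes a near-maximizer a near-eigenvector. *)
pose F x := m%:C *: x - D x.
have lF : linear F.
  by apply: linear_sub => //; apply: linear_scale; apply: linear_id.
have sF : symmetric_op F.
  by apply: symmetric_sub => //; apply: symmetric_scale; apply: symmetric_id.
have ripF x : rip (F x) x = m * rnorm x ^+ 2 - rip (D x) x.
  by rewrite /F ripDl ripNl ripZl ripxx.
pose L := m + 2 * K.
have FL x : rnorm (F x) ^+ 2 <= L * rip (F x) x.
  apply: (dominated_norm lF lF sF) => z.
    by rewrite ger0_norm// ripF subr_ge0.
  rewrite ripF /L mulrDl lerD2l.
  by apply: le_trans (absDK z); rewrite -normrN ler_norm.
have key x : rnorm x = 1 -> rip (D x) x ^+ 2 <= 2 * K * rnorm (F x).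
  move=> x1.
  have D2 : rip (D x) x ^+ 2 <= rnorm (D x) ^+ 2.
    rewrite -[leLHS]real_normK ?num_real// lerXn2r ?nnegrE ?rnorm_ge0//.
    by have := rip_cauchy_schwarz (D x) x; rewrite x1 mulr1.
  have AS2 : rnorm (A x) ^+ 2 = rnorm (S x) ^+ 2.
    by rewrite -!ripxx (rip_sym _ _ sA) (rip_sym _ _ sS) AS.
  have D2E : rnorm (D x) ^+ 2 = 2 * rip (F x) (S x) - 2 * m * rip (S x) x.
    rewrite -ripxx /F /D !ripE [rip x (S x)]ripC [rip (S x) (A x)]ripC.
    rewrite !ripxx AS2; ring.
  have FS : rip (F x) (S x) <= rnorm (F x) * K.
    apply: le_trans (ler_norm _) _; apply: le_trans (rip_cauchy_schwarz _ _) _.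
    by rewrite ler_wpM2l ?rnorm_ge0//; have := SK x; rewrite x1 mulr1.
  have : 0 <= m * rip (S x) x by rewrite mulr_ge0// ltW.
  lra.
(* With d = <D x, x>, the bounds FL and key give d^4 <= 4 K^2 L (m - d); the
   precision e makes the right-hand side smaller than (m/2)^4 <= d^4. *)
pose c := 4 * K ^+ 2 * L + 1.
have L0 : 0 <= L by rewrite /L addr_ge0 ?mulr_ge0// ltW.
have c1 : 0 <= 4 * K ^+ 2 * L by rewrite !mulr_ge0// sqr_ge0.
have c0 : 0 < c by rewrite ltr_wpDl.
pose e := Num.min (m / 2) (m ^+ 4 / (16 * c)).
have e0 : 0 < e by rewrite lt_min !divr_gt0 ?exprn_gt0 ?mulr_gt0.
have [_ [x /= x1 <-]] := sup_adherent e0 supE.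
rewrite -/m; set d := rip (D x) x => lt_d.
have e1 : e <= m / 2 by rewrite ge_min lexx.
have e2 : 16 * c * e <= m ^+ 4.
  by rewrite mulrC -ler_pdivlMr ?mulr_gt0// ge_min lexx orbT.
have dm : m / 2 <= d by lra.
have md : 0 <= m - d.
  by have := Em x; rewrite x1 expr1n mulr1 subr_ge0.
have f2 : rnorm (F x) ^+ 2 <= L * (m - d).
  by have := FL x; rewrite ripF x1 expr1n mulr1.
have d4 : d ^+ 4 <= 4 * K ^+ 2 * L * (m - d).
  have -> : d ^+ 4 = (d ^+ 2) ^+ 2 by ring.
  apply: (@le_trans _ _ ((2 * K * rnorm (F x)) ^+ 2)).
    by rewrite lerXn2r ?nnegrE ?sqr_ge0 ?mulr_ge0 ?rnorm_ge0// key.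
  have -> : (2 * K * rnorm (F x)) ^+ 2 = 4 * K ^+ 2 * rnorm (F x) ^+ 2 by ring.
  by rewrite -[leRHS]mulrA ler_wpM2l// mulr_ge0// sqr_ge0.
have m4 : m ^+ 4 <= 16 * d ^+ 4.
  have -> : 16 * d ^+ 4 = (2 * d) ^+ 4 by ring.
  by rewrite lerXn2r ?nnegrE; lra.
have : (c - 1) * (m - d) <= (c - 1) * e.
  by rewrite ler_wpM2l ?subr_ge0; rewrite /c; lra.
have : 4 * K ^+ 2 * L * (m - d) = (c - 1) * (m - d) by rewrite /c; ring.
move: d4 m4 e2 e0; lra.
Qed.

(** Both [A] and [- A] are symmetric square roots of [S^2]. *)
Lemma square_root_dominates A S (K : R) : linear A -> linear S ->
    symmetric_op A -> symmetric_op S -> 0 <= K ->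
    (forall x, rnorm (A x) <= K * rnorm x) ->
    (forall x, rnorm (S x) <= K * rnorm x) ->
    (forall x, 0 <= rip (S x) x) -> (forall x, A (A x) = S (S x)) ->
  forall x, `|rip (A x) x| <= rip (S x) x.
Proof.
move=> lA lS sA sS K0 AK SK S0 AS x; rewrite ler_norml; apply/andP; split.
  rewrite lerNl -ripNl.
  apply: (@square_root_upper_bound (fun x => - A x) S K) => //.
  - exact: linear_opp.
  - exact: symmetric_opp.
  - by move=> u; rewrite -(sub0r (A u)) rnormBC subr0.
  - by move=> u; rewrite (linN lA) opprK.
exact: (square_root_upper_bound lA lS sA sS K0).
Qed.

End domination.

(** * Convergence of sequences in a Hilbert space *)

Section limits.
Variables (R : realType) (H : innerProductType R).
Implicit Types (u v : nat -> H) (l k x y : H).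

Definition rcvg u l := (fun n => rnorm (u n - l)) @ \oo --> (0 : R).

(** Squeezing between zero and a real null sequence. *)
Lemma rcvg_dom u l (a : nat -> R) :
  (forall n, rnorm (u n - l) <= a n) -> a @ \oo --> (0 : R) -> rcvg u l.
Proof.
move=> ua a0; apply: (@squeeze_cvgr _ _ _ _ (fun=> 0) a) => //.
  by apply: nearW => n; rewrite rnorm_ge0 ua.
exact: cvg_cst.
Qed.

Lemma cst_le_lim (a : nat -> R) (c b : R) :
  (forall n, c <= a n) -> a @ \oo --> b -> c <= b.
Proof.
by move=> ca ab; apply: (ler_cvg_to (cvg_cst c) ab); apply: nearW.
Qed.

Lemma rcvg_unique u l k : rcvg u l -> rcvg u k -> l = k.
Proof.
move=> ul uk; apply/eqP; rewrite -subr_eq0; apply/eqP/rnorm0_eq0.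
apply/eqP; rewrite eq_le rnorm_ge0 andbT -(addr0 0).
apply: cst_le_lim (cvgD ul uk) => n /=.
by have := rnormD (l - u n) (u n - k); rewrite addrA subrK (rnormBC l (u n)).
Qed.

Lemma rcvg_rnorm_le u l (c : R) :
  (forall n, rnorm (u n) <= c) -> rcvg u l -> rnorm l <= c.
Proof.
move=> uc ul; rewrite -(add0r c).
apply: cst_le_lim (cvgD ul (cvg_cst c)) => n.
change (rnorm l <= rnorm (u n - l) + c); rewrite rnormBC.
have := rnormD (l - u n) (u n); rewrite subrK => /le_trans; apply.
by rewrite lerD2l.
Qed.

Lemma rcvgD u v l k : rcvg u l -> rcvg v k -> rcvg (fun n => u n + v n) (l + k).
Proof.
move=> ul vk; apply: (@rcvg_dom _ _ (fun n => rnorm (u n - l) + rnorm (v n - k))).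
  by move=> n; rewrite opprD addrACA rnormD.
by rewrite -(addr0 0); apply: cvgD.
Qed.

Lemma rcvgZ u l (a : R[i]) : rcvg u l -> rcvg (fun n => a *: u n) (a *: l).
Proof.
move=> ul; apply: (@rcvg_dom _ _ (fun n => rnorm a * rnorm (u n - l))).
  by move=> n; rewrite -scalerBr rnormZ.
by rewrite -(mulr0 (rnorm a)); apply: cvgM => //; apply: cvg_cst.
Qed.

Lemma rcvg_rip u l y : rcvg u l -> (fun n => rip (u n) y) @ \oo --> rip l y.
Proof.
move=> ul; apply/subr_cvg0/norm_cvg0P.
apply: (@squeeze_cvgr _ _ _ _ (fun=> 0) (fun n => rnorm (u n - l) * rnorm y)).
- apply: nearW => n; rewrite normr_ge0 /= -ripNl -ripDl.
  exact: rip_cauchy_schwarz.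
- exact: cvg_cst.
- by rewrite -(mul0r (rnorm y)); apply: cvgM => //; apply: cvg_cst.
Qed.

Lemma rcvg_cst l : rcvg (fun=> l) l.
Proof.
by apply: (@rcvg_dom _ _ (fun=> 0)) => [n|]; rewrite ?subrr ?rnorm0//; apply: cvg_cst.
Qed.

Lemma rcvg_shift u l : rcvg u l -> rcvg (fun n => u n.+1) l.
Proof. by rewrite /rcvg -(cvg_shiftS (fun n => rnorm (u n - l))). Qed.
End limits.

Section completeness.
Variables (R : realType) (H : hilbertType R).

Lemma rcauchy_rcvg (u : nat -> H) :
    (forall e : R, 0 < e ->
       exists N, forall n, (N <= n)%N -> rnorm (u n - u N) <= e) ->
  exists l, rcvg u l.
Proof.
move=> uc.
have : cauchy (u @ \oo).
  apply/cauchy_exP => e e0.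
  have eE : e = (complex.Re e)%:C by rewrite RRe_real// gtr0_real.
  have e'0 : 0 < complex.Re e / 2 by rewrite divr_gt0// -ltcR -eE.
  have [N uN] := uc _ e'0; exists (u N); exists N => // n /= Nn.
  rewrite -ball_normE /= rnormE eE ltcR rnormBC.
  by apply: le_lt_trans (uN _ Nn) _; lra.
move=> /cauchy_cvg/cvg_ex[l ul]; exists l.
apply/cvgrPdist_le => e e0.
have ec0 : 0 < e%:C by rewrite ltcR.
move/cvgrPdist_le: ul => /(_ _ ec0); apply: filterS => n.
by rewrite rnormE lecR sub0r normrN ger0_norm ?rnorm_ge0// rnormBC.
Qed.
End completeness.

(** * Bounded operators *)

Section bounded_operators.
Variables (R : realType) (H : hilbertType R).
Implicit Types (f g A S : H -> H) (x y : H).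

Definition norm_bound f (K : R) := forall x, rnorm (f x) <= K * rnorm x.

Lemma bounded_operatorP f :
  bounded_operator f <-> linear f /\ exists2 K : R, 0 <= K & norm_bound f K.
Proof.
split=> -[lf bf]; split => //.
  pose F : {linear H -> H} := HB.pack f (GRing.isLinear.Build _ _ _ _ f lf).
  have /linear_boundedP/pinfty_ex_gt0[K K0 FK] : bounded_near F (nbhs 0) by [].
  have KE : K = (complex.Re K)%:C by rewrite RRe_real// gtr0_real.
  exists (complex.Re K); first by rewrite -ler0c -KE ltW.
  by move=> x; rewrite -lecR rmorphM /= -KE -!rnormE; apply: FK.
have [K K0 fK] := bf.
apply/ex_bound; exists K%:C; apply/nbhs_norm0P; exists 1 => //= x /= x1.
rewrite rnormE lecR; apply: le_trans (fK x) _.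
by rewrite -[leRHS]mulr1 ler_wpM2l// -lecR -rnormE ltW.
Qed.

Lemma norm_boundD f g (K L : R) : norm_bound f K -> norm_bound g L ->
  norm_bound (fun x => f x + g x) (K + L).
Proof.
by move=> fK gL x; rewrite mulrDl; apply: le_trans (rnormD _ _) _; rewrite lerD.
Qed.

Lemma norm_boundZ f (a : R[i]) (K : R) : norm_bound f K ->
  norm_bound (fun x => a *: f x) (rnorm a * K).
Proof. by move=> fK x; rewrite rnormZ -mulrA ler_wpM2l ?rnorm_ge0. Qed.

Lemma norm_boundN f (K : R) : norm_bound f K -> norm_bound (fun x => - f x) K.
Proof. by move=> fK x; rewrite -(sub0r (f x)) rnormBC subr0. Qed.

Lemma symmetric_opP f : linear f ->
  symmetric_op f <-> forall x y, rip (f x) y = rip x (f y).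
Proof.
move=> lf; split=> [sf x y|sf x y]; first exact: rip_sym.
by apply: inner_eq_rip => a; rewrite -(linZ lf).
Qed.

Lemma symmetric_inner f x : symmetric_op f -> inner (f x) x = (rip (f x) x)%:C.
Proof.
move=> sf; rewrite /rip; have := inner_conj (f x) x.
rewrite -sf; case: (inner (f x) x) => p q /= [q0].
by congr (_ +i* _); lra.
Qed.

(** Since the form of [S] at [i x + y] is real, so is the cross term
[i (<S x, y> - <S y, x>)], which compares the real parts of [<S x, y>] and
[<S y, x>]. *)
Lemma positive_symmetric S : positive_operator S -> symmetric_op S.
Proof.
move=> [[lS _] S0]; apply/(symmetric_opP lS) => x y.
have im0 z : complex.Im (inner (S z) z) = 0 by apply: ger0_Im.
have := im0 ('i *: x + y); rewrite !(linD lS, linZ lS) !innerE.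
have := im0 x; have := im0 y; rewrite /rip (inner_conj (S y) x).
case: (inner (S x) x) => a b /=; case: (inner (S y) y) => c d /=.
case: (inner (S x) y) => p q; case: (inner (S y) x) => r s /= -> -> /=.
lra.
Qed.

Lemma rip_inj y z : (forall x, rip x y = rip x z) -> y = z.
Proof.
move=> yz; apply/eqP; rewrite -subr_eq0; apply/eqP/rnorm0_eq0/eqP.
by rewrite -sqrf_eq0 -ripxx ripDr ripNr yz subrr.
Qed.

End bounded_operators.

(** * Riesz representation and adjoints *)

Section riesz.
Variables (R : realType) (H : hilbertType R) (p : H -> R) (M : R).
Hypothesis pD : forall x y, p (x + y) = p x + p y.
Hypothesis pZ : forall (r : R) x, p (r%:C *: x) = r * p x.
Hypothesis pM : forall x, `|p x| <= M * rnorm x.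

Let J x := rnorm x ^+ 2 - 2 * p x.

(** The representing vector minimizes [J x = ||x||^2 - 2 p x].  By the
parallelogram law a minimizing sequence [u] is Cauchy.  Near-minimality of
[u n] against the perturbation [u n + t x] passes to the limit [z] as
[t^2 ||x||^2 + 2 t (<z, x> - p x) >= 0] for all [t], which forces
[<z, x> = p x]. *)
Lemma riesz_real : exists z, forall x, p x = rip x z.
Proof.
pose E := [set - J x | x in [set: H]].
have ubE : ubound E (M ^+ 2).
  move=> _ [x _ <-]; rewrite /J.
  have := pM x; rewrite ler_norml => /andP[_ h].
  have := sqr_ge0 (M - rnorm x).
  rewrite sqrrB; lra.
have supE : has_sup E by split; [exists (- J 0), 0|exists (M ^+ 2)].
pose m := sup E.
have mJ x : - J x <= m by apply: sup_upper_bound => //; exists x.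
have [u um] : exists u : nat -> H, forall n, m - n.+1%:R^-1 < - J (u n).
  suff : forall n, exists x, m - n.+1%:R^-1 < - J x by move=> /choice[u um]; exists u.
  move=> n; have n0 : 0 < n.+1%:R^-1 :> R by rewrite invr_gt0 ltr0n.
  by have [_ [x _ <-] xm] := sup_adherent n0 supE; exists x.
(* Parallelogram law, with J at the midpoint bounded below by - m. *)
have Juv x y : rnorm (x - y) ^+ 2 <= 2 * (J x + J y + 2 * m).
  have := mJ ((2^-1)%:C *: (x + y)).
  rewrite /J -!ripxx pZ pD !ripE [rip y x]ripC; lra.
have [z uz] : exists z, rcvg u z.
  apply: rcauchy_rcvg => e e0.
  have e20 : 0 < e ^+ 2 / 4 by rewrite divr_gt0 ?exprn_gt0.
  have [N Ne] := ltr_add_invr e20; exists N => n Nn.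
  rewrite -(@ler_pXn2r _ 2) ?nnegrE ?rnorm_ge0 ?(ltW e0)//.
  have nN : n.+1%:R^-1 <= N.+1%:R^-1 :> R by rewrite lef_pV2 ?posrE// ler_nat.
  apply: le_trans (Juv _ _) _; move: (um n) (um N) nN Ne.
  by rewrite add0r; move: (J _) (J _) n.+1%:R^-1 N.+1%:R^-1 => a b c d; lra.
exists z => x.
have q t : 0 <= t ^+ 2 * rnorm x ^+ 2 + 2 * t * (rip z x - p x).
  pose a n := t ^+ 2 * rnorm x ^+ 2 + 2 * t * (rip (u n) x - p x) + n.+1%:R^-1.
  have a0 n : 0 <= a n.
    have := mJ (u n + t%:C *: x); have := um n.
    rewrite /a /J -!ripxx !pD !pZ !ripE [rip x (u n)]ripC.
    by move: n.+1%:R^-1 => r; lra.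
  apply: (cst_le_lim a0); rewrite -[X in _ --> X]addr0.
  apply: cvgD; last exact: cvg_harmonic.
  apply: cvgD; first exact: cvg_cst.
  apply: cvgM; first exact: cvg_cst.
  by apply: cvgB; [exact: rcvg_rip|exact: cvg_cst].
set P := rnorm x ^+ 2 in q; set g := rip z x - p x in q.
have P0 : 0 < P + 1 by rewrite ltr_wpDl// sqr_ge0.
have g0 : g = 0.
  (* P + 1 instead of P, since P may vanish. *)
  have := q (- g / (P + 1)).
  have -> : (- g / (P + 1)) ^+ 2 * P + 2 * (- g / (P + 1)) * g =
      - (g ^+ 2 * ((P + 2) / (P + 1) ^+ 2)) by field; rewrite gt_eqF.
  rewrite oppr_ge0 pmulr_lle0; last by rewrite divr_gt0 ?exprn_gt0//; lra.
  by move=> g2; apply/eqP; rewrite -sqrf_eq0 eq_le g2 sqr_ge0.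
by rewrite ripC; move: g0; rewrite /g; lra.
Qed.

End riesz.

Section adjoint.
Variables (R : realType) (H : hilbertType R).
Implicit Types (f g A S : H -> H) (x y : H).

(** For fixed [y], Riesz representation applies to the functional
[x |-> Re <f x, y>]; its complex counterpart follows by complex linearity. *)
Lemma adjoint_spec f : bounded_operator f ->
  forall x y, inner (f x) y = inner x (adjoint f y).
Proof.
move=> /bounded_operatorP[lf [K K0 fK]].
suff : exists g, forall x y, inner (f x) y = inner x (g y).
  by move=> /(xgetPex \0).
suff /choice[g fg] : forall y, exists z, forall x, rip (f x) y = rip x z.
  exists g => x y; apply: inner_eq_rip => a.
  by rewrite -(linZ lf) fg.
move=> y; apply: (@riesz_real _ _ (fun x => rip (f x) y) (K * rnorm y)).
- by move=> u v; rewrite (linD lf) ripDl.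
- by move=> r u; rewrite (linZ lf) ripZl.
- move=> u; apply: le_trans (rip_cauchy_schwarz _ _) _.
  by rewrite mulrAC ler_wpM2r ?rnorm_ge0.
Qed.

Lemma adjoint_rip f : bounded_operator f ->
  forall x y, rip (f x) y = rip x (adjoint f y).
Proof. by move=> bf x y; rewrite /rip adjoint_spec. Qed.

Lemma adjoint_linear f : bounded_operator f -> linear (adjoint f).
Proof.
move=> bf a y z; apply: rip_inj => x.
rewrite /rip -adjoint_spec// !innerE !adjoint_spec//.
Qed.

Lemma adjoint_norm_bound f (K : R) : bounded_operator f -> 0 <= K ->
  norm_bound f K -> norm_bound (adjoint f) K.
Proof.
move=> bf K0 fK y; set n := rnorm _.
have [->|n0] := eqVneq n 0; first by rewrite mulr_ge0// rnorm_ge0.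
have {}n0 : 0 < n by rewrite lt_def n0 rnorm_ge0.
rewrite -(ler_pM2l n0) -expr2 -ripxx -adjoint_rip//.
apply: le_trans (ler_norm _) _; apply: le_trans (rip_cauchy_schwarz _ _) _.
by rewrite mulrA [n * K]mulrC ler_wpM2r ?rnorm_ge0// fK.
Qed.

Lemma adjoint_symmetric f : bounded_operator f -> symmetric_op f -> adjoint f = f.
Proof.
move=> bf sf; apply/funext => y; apply: rip_inj => x.
by rewrite -adjoint_rip// rip_sym.
Qed.

End adjoint.

(** * Square roots of positive operators *)

Section square_root.
Variables (R : realType) (H : hilbertType R).
Implicit Types (A P S : H -> H) (x y : H).

(** The iteration [t := (q + t^2) / 2] for [1 - sqrt (1 - q)], at [q = 1]: a
scalar majorant of the operator iteration below. *)
Fixpoint sqrt_scalar (n : nat) : R :=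
  if n is n'.+1 then (1 + sqrt_scalar n' ^+ 2) / 2 else 0.

Lemma sqrt_scalar_itv n : 0 <= sqrt_scalar n <= 1.
Proof.
elim: n => [|n /= /andP[h0 h1]]; first by rewrite /= lexx ler01.
by apply/andP; split; nra.
Qed.

Lemma sqrt_scalar_nondecreasing : {homo sqrt_scalar : m n / (m <= n)%N >-> m <= n}.
Proof.
apply: homo_leq => // [b a c|n]; first exact: le_trans.
by rewrite /=; have := sqr_ge0 (sqrt_scalar n - 1); lra.
Qed.

Section iteration.
Variable Q : H -> H.
Hypotheses (lQ : linear Q) (sQ : symmetric_op Q) (Q1 : norm_bound Q 1).

(** The same iteration with the operator [Q] in place of [q]; its limit [L]
satisfies [(1 - L)^2 = 1 - Q]. *)
Fixpoint sqrt_iter (n : nat) (x : H) : H :=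
  if n is n'.+1 then 2^-1 *: (Q x + sqrt_iter n' (sqrt_iter n' x)) else 0.

Local Notation Y := sqrt_iter.
Local Notation t := sqrt_scalar.

Lemma half_real : 2^-1 = (2^-1)%:C :> R[i].
Proof. by rewrite fmorphV /= rmorphMn. Qed.

Lemma sqrt_iter_linear n : linear (Y n).
Proof.
elim: n => [|n IHn] /=; first by move=> a x y; rewrite scaler0 addr0.
apply: linear_scale; apply: linear_add => //; exact: linear_comp.
Qed.

Lemma sqrt_iter_symmetric n : symmetric_op (Y n).
Proof.
elim: n => [x y|n IHn] /=; first by rewrite linear0l linear0r.
by move=> x y; rewrite half_real !innerE sQ !IHn conjc_real.
Qed.

Lemma rnorm_half x : rnorm (2^-1 *: x) = 2^-1 * rnorm x.
Proof. by rewrite half_real rnormZ rnorm_real ger0_norm// invr_ge0. Qed.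

Lemma sqrt_iter_bound n : norm_bound (Y n) (t n).
Proof.
elim: n => [x|n IHn x] /=; first by rewrite rnorm0 mul0r.
have /andP[t0 t1] := sqrt_scalar_itv n.
rewrite rnorm_half; have := rnormD (Q x) (Y n (Y n x)).
have := Q1 x; have := IHn (Y n x).
have : t n * rnorm (Y n x) <= t n * (t n * rnorm x) by rewrite ler_wpM2l.
lra.
Qed.

(** Writing [Y] and [Y'] for consecutive iterates,
[Y' Y' - Y Y = Y' (Y' - Y) + (Y' - Y) Y], so the scalar increments dominate the
operator increments. *)
Lemma sqrt_iter_step n x : rnorm (Y n.+1 x - Y n x) <= (t n.+1 - t n) * rnorm x.
Proof.
elim: n x => [|n IHn] x.
  rewrite /= subr0 addr0 rnorm_half expr0n /= addr0 subr0 mul1r.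
  by rewrite ler_wpM2l ?invr_ge0//; have := Q1 x; rewrite mul1r.
have -> : Y n.+2 x - Y n.+1 x =
    2^-1 *: (Y n.+1 (Y n.+1 x - Y n x) + (Y n.+1 (Y n x) - Y n (Y n x))).
  rewrite (linB (sqrt_iter_linear n.+1)) addrA subrK.
  rewrite [Y n.+2 x]/= [in X in _ - X]/= -scalerBr.
  by congr (_ *: _); rewrite opprD addrACA subrr add0r.
have /andP[t0 t1] := sqrt_scalar_itv n.
have /andP[u0 u1] := sqrt_scalar_itv n.+1.
have tu : 0 <= t n.+1 - t n by rewrite subr_ge0 sqrt_scalar_nondecreasing.
have tE : t n.+2 - t n.+1 = 2^-1 * (t n.+1 * (t n.+1 - t n) + (t n.+1 - t n) * t n).
  have -> : t n.+2 - t n.+1 = (1 + t n.+1 ^+ 2) / 2 - (1 + t n ^+ 2) / 2 by [].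
  by field.
rewrite rnorm_half tE -mulrA ler_wpM2l ?invr_ge0// mulrDl.
apply: le_trans (rnormD _ _) _; apply: lerD.
  apply: le_trans (sqrt_iter_bound _ _) _.
  by rewrite -mulrA ler_wpM2l.
apply: le_trans (IHn _) _.
by rewrite -mulrA ler_wpM2l// sqrt_iter_bound.
Qed.

Lemma sqrt_iter_dist m n x : (m <= n)%N ->
  rnorm (Y n x - Y m x) <= (t n - t m) * rnorm x.
Proof.
move=> /subnKC <-; elim: (n - m)%N => [|k IHk].
  by rewrite addn0 !subrr rnorm0 mul0r.
rewrite addnS; have := rnormD (Y (m + k).+1 x - Y (m + k)%N x) (Y (m + k)%N x - Y m x).
rewrite addrA subrK; have := sqrt_iter_step (m + k) x.
move: IHk; rewrite !mulrBl; lra.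
Qed.

(** The scalar iterates increase and are bounded, and their differences
dominate the distances between the operator iterates. *)
Lemma sqrt_iter_limit : exists L, forall x, rcvg (fun n => Y n x) (L x).
Proof.
suff : forall x, exists l, rcvg (fun n => Y n x) l by move=> /choice[L YL]; exists L.
move=> x; apply: rcauchy_rcvg => e e0.
pose E := range t.
have supE : has_sup E.
  split; first by exists (t 0), 0%N.
  by exists 1 => _ [n _ <-]; have /andP[] := sqrt_scalar_itv n.
have d0 : 0 < e / (rnorm x + 1).
  by rewrite divr_gt0// ltr_wpDl// rnorm_ge0.
have [_ [N _ <-] tN] := sup_adherent d0 supE.
exists N => n Nn; apply: le_trans (sqrt_iter_dist x Nn) _.
have tn : t n <= sup E by apply: sup_upper_bound => //; exists n.
have tNn : t n - t N <= e / (rnorm x + 1) by lra.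
apply: le_trans (ler_wpM2r (rnorm_ge0 x) tNn) _.
rewrite mulrAC ler_pdivrMr ?ltr_wpDl ?rnorm_ge0//.
by rewrite ler_wpM2l ?(ltW e0)// lerDl.
Qed.

(** The root is [1 - L] with [L] the limit of the iterates; it is positive
because [||L|| <= 1]. *)
Lemma sqrt_one_sub : exists S : H -> H, [/\ linear S, symmetric_op S,
  norm_bound S 2, forall x, 0 <= rip (S x) x & forall x, S (S x) = x - Q x].
Proof.
have [L YL] := sqrt_iter_limit.
have t1 n : t n <= 1 by have /andP[] := sqrt_scalar_itv n.
have Y1 n x : rnorm (Y n x) <= rnorm x.
  apply: le_trans (sqrt_iter_bound _ _) _.
  by rewrite -[leRHS]mul1r ler_wpM2r ?rnorm_ge0.
have lL : linear L.
  move=> a x y; apply: rcvg_unique (YL _) _.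
  rewrite (_ : (fun n => _) = (fun n => a *: Y n x + Y n y)).
    by apply: rcvgD (YL _); apply: rcvgZ.
  by apply/funext => n; rewrite sqrt_iter_linear.
have sL : symmetric_op L.
  apply/(symmetric_opP lL) => x y.
  have xy := @rcvg_rip _ _ _ _ y (YL x); have yx := @rcvg_rip _ _ _ _ x (YL y).
  rewrite [RHS]ripC; apply: cvg_unique xy _ => //.
  rewrite (_ : (fun n => _) = (fun n => rip (Y n y) x))//.
  by apply/funext => n; rewrite ripC (rip_sym _ _ (sqrt_iter_symmetric n)).
have L1 x : rnorm (L x) <= rnorm x by apply: rcvg_rnorm_le (YL x).
have LL x : L x = 2^-1 *: (Q x + L (L x)).
  apply: rcvg_unique (rcvg_shift (YL x)) _; apply: rcvgZ.
  apply: rcvgD; first exact: rcvg_cst.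
  apply: (@rcvg_dom _ _ _ _ (fun n => rnorm (Y n x - L x) + rnorm (Y n (L x) - L (L x)))).
    move=> n; have := rnormD (Y n (Y n x) - Y n (L x)) (Y n (L x) - L (L x)).
    rewrite addrA subrK => /le_trans; apply; rewrite lerD2r.
    by rewrite -(linB (sqrt_iter_linear n)).
  by rewrite -(addr0 0); apply: cvgD; apply: YL.
exists (fun x => x - L x); split.
- exact: linear_sub.
- by apply: symmetric_sub => //; apply: symmetric_id.
- move=> x; have := norm_boundN (K := 1) (f := L).
  move=> /(_ _ x); rewrite mul1r => h.
  apply: le_trans (rnormD _ _) _; rewrite mulr_natl mulr2n lerD2l h//.
  by move=> z; rewrite mul1r.
- move=> x; rewrite ripDl ripNl ripxx subr_ge0.
  apply: le_trans (ler_norm _) _; apply: le_trans (rip_cauchy_schwarz _ _) _.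
  by rewrite expr2 ler_wpM2r ?rnorm_ge0.
- move=> x; rewrite (linB lL).
  have Lx2 : L x + L x = Q x + L (L x).
    by rewrite -mulr2n -scaler_nat {1}LL scalerA divff ?scale1r.
  have -> : Q x = L x + L x - L (L x) by rewrite Lx2 addrK.
  by rewrite !opprB opprD !addrA; congr (_ - _); rewrite addrAC.
Qed.

End iteration.

(** After division by [k], the operator [Q = 1 - P / k] lies between [0] and
[1], hence has norm at most [1]. *)
Lemma sqrt_exists P (K : R) : linear P -> symmetric_op P -> 0 <= K ->
    norm_bound P K -> (forall x, 0 <= rip (P x) x) ->
  exists S, positive_operator S /\ S \o S = P.
Proof.
move=> lP sP K0' PK' P0.
(* K may be zero, so it cannot serve as the scaling factor. *)
pose k := K + 1.
have k0 : 0 < k by rewrite ltr_wpDl.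
have Pk x : rip (P x) x <= k * rnorm x ^+ 2.
  apply: le_trans (ler_norm _) _; apply: le_trans (rip_cauchy_schwarz _ _) _.
  rewrite expr2 mulrA ler_wpM2r ?rnorm_ge0//; apply: le_trans (PK' x) _.
  by rewrite ler_wpM2r ?rnorm_ge0// lerDl.
pose Q x := x - (k^-1)%:C *: P x.
have lQ : linear Q.
  by apply: linear_sub; [exact: linear_id|exact: linear_scale].
have sQ : symmetric_op Q.
  by apply: symmetric_sub; [exact: symmetric_id|exact: symmetric_scale].
have Q1 : norm_bound Q 1.
  apply: symmetric_norm => // x.
  rewrite /Q ripDl ripNl ripZl ripxx mul1r.
  have : k^-1 * rip (P x) x <= rnorm x ^+ 2.
    by rewrite ler_pdivrMl.
  have : 0 <= k^-1 * rip (P x) x by rewrite mulr_ge0// invr_ge0 ltW.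
  by rewrite ler_norml; lra.
have [S [lS sS SK S0 SS]] := sqrt_one_sub lQ sQ Q1.
pose r := Num.sqrt k.
have r0 : 0 <= r by apply: sqrtr_ge0.
exists (fun x => r%:C *: S x); split; last first.
  apply/funext => x /=; rewrite (linZ lS) scalerA -rmorphM SS /Q /=.
  rewrite -expr2 sqr_sqrtr ?(ltW k0)//.
  rewrite opprB addrC subrK scalerA -rmorphM /= divff ?gt_eqF//.
  by rewrite scale1r.
have lrS : linear (fun x => r%:C *: S x) by apply: linear_scale.
have srS : symmetric_op (fun x => r%:C *: S x) by apply: symmetric_scale.
split.
  apply/bounded_operatorP; split => //.
  exists (rnorm r%:C * 2); first by rewrite mulr_ge0// rnorm_ge0.
  exact: norm_boundZ.
by move=> x; rewrite (symmetric_inner _ srS) ler0c ripZl mulr_ge0.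
Qed.

End square_root.

(** * The suprema *)

Section suprema.
Variables (R : realType) (H : hilbertType R).
Implicit Types (f g A B : H -> H) (x y : H).

Lemma unit_ball x : (`|x| <= 1) = (rnorm x <= 1).
Proof. by rewrite rnormE -(rmorph1 (real_complex R)) lecR. Qed.

Lemma unit_sphere x : `|x| = 1 <-> rnorm x = 1.
Proof. by rewrite rnormE; split=> [[]|->]. Qed.

Lemma opnorm_le f (c : R) :
  (forall x, rnorm x <= 1 -> rnorm (f x) <= c) -> opnorm f <= c.
Proof.
move=> fc; apply: ge_sup.
  by exists (rnorm (f 0)), 0 => //=; rewrite normr0.
by move=> _ [x /= x1 <-]; apply: fc; rewrite -unit_ball.
Qed.

Lemma opnorm_norm_bound f (K : R) : linear f -> 0 <= K -> norm_bound f K ->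
  norm_bound f (opnorm f).
Proof.
move=> lf K0 fK x.
have [->|x0] := eqVneq x 0; first by rewrite (lin0 lf) !rnorm0 mulr0.
have [u u1 {1}->] := normalize x0.
rewrite (linZ lf) rnormZ rnorm_real ger0_norm ?rnorm_ge0// mulrC.
rewrite ler_wpM2r ?rnorm_ge0//; apply: ub_le_sup.
  exists K => _ [y /= y1 <-]; apply: le_trans (fK y) _.
  by rewrite -[leRHS]mulr1 ler_wpM2l// -unit_ball.
by exists u => //=; rewrite unit_ball u1.
Qed.

Lemma opnorm_ge0 f (K : R) : 0 <= K -> norm_bound f K -> 0 <= opnorm f.
Proof.
move=> K0 fK; apply: le_trans (rnorm_ge0 (f 0)) _; apply: ub_le_sup.
  exists K => _ [y /= y1 <-]; apply: le_trans (fK y) _.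
  by rewrite -[leRHS]mulr1 ler_wpM2l// -unit_ball.
by exists 0 => //=; rewrite normr0.
Qed.

(** The bound [c] has to be nonnegative because the unit sphere of the zero
space is empty, and then the numerical radius is [0]. *)
Lemma numerical_radius_le f (c : R) : 0 <= c ->
  (forall x, rnorm x = 1 -> rnorm (inner (f x) x) <= c) ->
  numerical_radius f <= c.
Proof.
move=> c0 fc; rewrite /numerical_radius; set E := [set _ | _ in _].
have [->|/set0P E0] := eqVneq E set0; first by rewrite sup0.
by apply: ge_sup => // _ [x /= /unit_sphere x1 <-]; apply: fc.
Qed.

Lemma numerical_radius_has_ubound f (K : R) : norm_bound f K ->
  has_ubound [set complex.Re `|inner (f x) x| | x in [set x : H | `|x| = 1]].
Proof.
move=> fK; exists K => _ [x /= /unit_sphere x1 <-].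
apply: le_trans (cauchy_schwarz _ _) _.
by rewrite x1 mulr1; have := fK x; rewrite x1 mulr1.
Qed.

Lemma numerical_radius_ge0 f (K : R) : norm_bound f K -> 0 <= numerical_radius f.
Proof.
move=> /numerical_radius_has_ubound; rewrite /numerical_radius.
set E := [set _ | _ in _] => ubE.
have [->|/set0P[e Ee]] := eqVneq E set0; first by rewrite sup0.
apply: le_trans (ub_le_sup ubE Ee).
by case: Ee => x _ <-; exact: (rnorm_ge0 (inner (f x) x)).
Qed.

Lemma inner_le_numerical_radius f (K : R) : linear f -> norm_bound f K ->
  forall x, rnorm (inner (f x) x) <= numerical_radius f * rnorm x ^+ 2.
Proof.
move=> lf fK x.
have [->|x0] := eqVneq x 0.
  by rewrite (lin0 lf) linear0l rnorm0 rnorm0 expr0n mulr0.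
have [u u1 xE] := normalize x0.
rewrite {1 2}xE (linZ lf) !innerE !rnormM conjc_real mulrA -rnormM -rmorphM.
rewrite rnorm_real ger0_norm ?mulr_ge0 ?rnorm_ge0// -expr2 mulrC.
rewrite ler_wpM2r ?sqr_ge0//; apply: ub_le_sup.
  exact: numerical_radius_has_ubound fK.
by exists u => //=; apply/unit_sphere.
Qed.

Lemma euclidean_opnorm_le A B (c : R) :
  (forall a b : R[i], rnorm a ^+ 2 + rnorm b ^+ 2 <= 1 ->
    opnorm (a \*: A \+ b \*: B) <= c) ->
  euclidean_opnorm A B <= c.
Proof.
move=> ABc; apply: ge_sup.
  exists (opnorm (0 \*: A \+ 0 \*: B)), (0, 0) => //=.
  by rewrite normr0 expr0n addr0.
move=> _ [[a b] /= ab <-]; apply: ABc.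
by move: ab; rewrite !rnormE -!rmorphXn -rmorphD -(rmorph1 (real_complex R)) lecR.
Qed.

Lemma opnorm_le_euclidean A B (K L : R) : 0 <= K -> 0 <= L ->
    norm_bound A K -> norm_bound B L ->
  forall a b : R[i], rnorm a ^+ 2 + rnorm b ^+ 2 <= 1 ->
    opnorm (a \*: A \+ b \*: B) <= euclidean_opnorm A B.
Proof.
move=> K0 L0 AK BL a b ab; apply: ub_le_sup; last first.
  exists (a, b) => //=.
  by rewrite !rnormE -!rmorphXn -rmorphD -(rmorph1 (real_complex R)) lecR.
exists (K + L) => _ [[a' b'] /= ab' <-].
have {ab'} : rnorm a' ^+ 2 + rnorm b' ^+ 2 <= 1.
  by move: ab'; rewrite !rnormE -!rmorphXn -rmorphD -(rmorph1 (real_complex R)) lecR.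
move=> ab'; have a0 := rnorm_ge0 a'; have b0 := rnorm_ge0 b'.
have a1 : rnorm a' <= 1 by nra.
have b1 : rnorm b' <= 1 by nra.
apply: opnorm_le => x x1.
have x0 := rnorm_ge0 x.
apply: le_trans (rnormD _ _) _; rewrite !rnormZ.
have Ax : rnorm (A x) <= K.
  by apply: le_trans (AK x) _; rewrite -[leRHS]mulr1 ler_wpM2l.
have Bx : rnorm (B x) <= L.
  by apply: le_trans (BL x) _; rewrite -[leRHS]mulr1 ler_wpM2l.
by apply: lerD; rewrite -[leRHS]mul1r ler_pM ?rnorm_ge0.
Qed.

Lemma rnorm_le_inner z (c : R) : 0 <= c ->
  (forall y, rnorm (inner z y) <= c * rnorm y) -> rnorm z <= c.
Proof.
move=> c0 zc; have [->//|z0] := eqVneq (rnorm z) 0.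
have {}z0 : 0 < rnorm z by rewrite lt_def z0 rnorm_ge0.
rewrite -(ler_pM2r z0) -expr2 -ripxx; apply: le_trans (zc z).
by apply: le_trans (Re_le_rnorm _); rewrite ler_norm.
Qed.

End suprema.

(** * Absolute value and the mixed Schwarz inequality *)

Section abs_operator.
Variables (R : realType) (H : hilbertType R) (A : H -> H).
Hypotheses (bA : bounded_operator A) (sA : symmetric_op A).

Lemma abs_operator_spec : positive_operator (abs_operator A) /\
  forall x, abs_operator A (abs_operator A x) = A (A x).
Proof.
have /bounded_operatorP[lA [K K0 AK]] := bA.
have : exists S, positive_operator S /\ S \o S = adjoint A \o A.
  rewrite adjoint_symmetric//; apply: (@sqrt_exists _ _ _ (K * K)).
  - exact: linear_comp.
  - by move=> x y /=; rewrite !sA.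
  - exact: mulr_ge0.
  - by move=> x /=; apply: le_trans (AK _) _; rewrite -mulrA ler_wpM2l.
  - by move=> x /=; rewrite (rip_sym _ _ sA) ripxx sqr_ge0.
move=> /(xgetPex \0); rewrite -/(sqrt_operator _) -/(abs_operator A) => -[pS SS].
split=> // x; have : (abs_operator A \o abs_operator A) x = (adjoint A \o A) x.
  by rewrite SS.
by rewrite /= adjoint_symmetric.
Qed.

Lemma abs_operator_bounded : bounded_operator (abs_operator A).
Proof. by case: abs_operator_spec => -[]. Qed.

Lemma abs_operator_symmetric : symmetric_op (abs_operator A).
Proof. by case: abs_operator_spec => pS _; apply: positive_symmetric. Qed.

Lemma abs_operator_ge0 x : 0 <= rip (abs_operator A x) x.
Proof.
case: abs_operator_spec => -[_ /(_ x)] + _.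
by rewrite symmetric_inner ?ler0c//; apply: abs_operator_symmetric.
Qed.

Lemma rnorm_abs_operator x : rnorm (abs_operator A x) = rnorm (A x).
Proof.
apply/eqP; rewrite -(@eqrXn2 _ 2) ?rnorm_ge0// -!ripxx.
rewrite (rip_sym _ _ sA) (rip_sym _ _ abs_operator_symmetric).
by case: abs_operator_spec => _ ->.
Qed.

(** Since [-|A| <= A <= |A|] as quadratic forms, polarization applies. *)
Lemma mixed_schwarz x y : rnorm (inner (A x) y) ^+ 2 <=
  rip (abs_operator A x) x * rip (abs_operator A y) y.
Proof.
have /bounded_operatorP[lA [K K0 AK]] := bA.
have /bounded_operatorP[lS _] := abs_operator_bounded.
apply: domination => // z.
apply: (square_root_dominates lA lS sA abs_operator_symmetric K0 AK).
- by move=> u; rewrite rnorm_abs_operator.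
- exact: abs_operator_ge0.
- by move=> u; case: abs_operator_spec => _ ->.
Qed.

End abs_operator.

(** * The off-diagonal block operator *)

Section off_diagonal.
Variables (R : realType) (H : hilbertType R) (A B : H -> H) (K : R).
Hypotheses (lA : linear A) (lB : linear B) (K0 : 0 <= K).
Hypotheses (AK : norm_bound A K) (BK : norm_bound B K).
Hypothesis sB : symmetric_op B.

Local Notation M := (block_operator \0 A B \0).

Lemma inner_hsum (u v : hsum H H) : inner u v = inner u.1 v.1 + inner u.2 v.2.
Proof. by []. Qed.

Lemma rnorm_hsum (u : hsum H H) : rnorm u ^+ 2 = rnorm u.1 ^+ 2 + rnorm u.2 ^+ 2.
Proof. by rewrite -!ripxx -complexReD -inner_hsum. Qed.

Lemma off_diagonalE (u : hsum H H) : M u = (A u.2, B u.1) :> hsum H H.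
Proof. by rewrite /block_operator /= add0r addr0. Qed.

Lemma off_diagonal_linear : linear (M : hsum H H -> hsum H H).
Proof. by move=> a u v; rewrite !off_diagonalE /= lA lB. Qed.

Lemma off_diagonal_norm_bound : norm_bound (M : hsum H H -> hsum H H) K.
Proof.
move=> u; rewrite -(@ler_pXn2r _ 2) ?nnegrE ?mulr_ge0 ?rnorm_ge0//.
rewrite exprMn !rnorm_hsum off_diagonalE /= addrC mulrDr.
by rewrite -!exprMn lerD// lerXn2r ?nnegrE ?mulr_ge0 ?rnorm_ge0 ?AK ?BK.
Qed.

Lemma inner_off_diagonal (u : hsum H H) :
  inner (M u) u = inner (A u.2) u.1 + (inner (B u.2) u.1)^*%C.
Proof. by rewrite off_diagonalE inner_hsum /= -inner_conj sB. Qed.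

(** With [a = <A x, y>] and [b = <B x, y>], the form of [M] at [(c y, x)] is
[v = c^* a + c b^*].  Take a unit [p] with [p (a + i b) = |a + i b|] and
[z = exp(- i pi / 4)], so that [z^2 = - i].  Then [c = p^* z] gives
[z v = p a + (p i b)^*], whose real part is [|a + i b|]. *)
Lemma inner_le_off_diagonal x y : rnorm (inner (A x + 'i *: B x) y) <=
  numerical_radius M * (rnorm x ^+ 2 + rnorm y ^+ 2).
Proof.
set a := inner (A x) y; set b := inner (B x) y.
have -> : inner (A x + 'i *: B x) y = a + 'i * b by rewrite !innerE.
have [p p1 pE] := unit_phase (a + 'i * b).
pose r : R := (Num.sqrt 2)^-1.
have r2 : r ^+ 2 = 2^-1 by rewrite exprVn sqr_sqrtr.
pose z : R[i] := Complex r (- r).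
have z1 : rnorm z = 1.
  apply/eqP; rewrite -(@eqrXn2 _ 2) ?rnorm_ge0// rnormC_sqr /= sqrrN r2.
  by apply/eqP; field.
pose c := p^*%C * z.
have c1 : rnorm c = 1 by rewrite rnormM {1}/rnorm normcJ -/(rnorm p) p1 z1 mulr1.
have := inner_le_numerical_radius off_diagonal_linear off_diagonal_norm_bound
  ((c *: y, x) : hsum H H).
rewrite inner_off_diagonal rnorm_hsum /= rnormZ c1 mul1r [X in _ * X]addrC.
rewrite !innerZr -/a -/b; apply: le_trans.
rewrite -[leRHS]mul1r -z1 -rnormM; apply: le_trans (Re_le_rnorm _).
apply: le_trans (ler_norm _).
have -> : rnorm (a + 'i * b) = complex.Re (p * (a + 'i * b)) by rewrite pE.
move: r2; rewrite /c /z; clear pE.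
case: (p) => p' p''; case: a => a' a''; case: b => b' b''.
move=> r2; have {}r2 : 1 = 2 * r ^+ 2 by rewrite r2; field.
by rewrite -[leLHS]mul1r [in leLHS]r2 le_eqVlt; apply/orP; left; apply/eqP => /=; ring.
Qed.

(** In [inner_le_off_diagonal], take for [y] the unit vector in the direction of
[A x + i B x]. *)
Lemma rnorm_le_off_diagonal x : rnorm x <= 1 ->
  rnorm (A x + 'i *: B x) <= 2 * numerical_radius M.
Proof.
move=> x1; set z := A x + _; have w0 := numerical_radius_ge0 off_diagonal_norm_bound.
have [->|z0] := eqVneq z 0; first by rewrite rnorm0 mulr_ge0.
have [u u1 zE] := normalize z0.
have := inner_le_off_diagonal x u; rewrite -/z {1}zE innerZl innerxx rnormE u1.
rewrite rmorph1 !expr1n mulr1 rnorm_real ger0_norm ?rnorm_ge0// => /le_trans.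
apply; rewrite mulrC ler_wpM2r//.
have : rnorm x ^+ 2 <= 1 by rewrite expr_le1// rnorm_ge0.
lra.
Qed.

(** The unit phases of [a = <A u2, u1>] and [b = <B u2, u1>], conjugated and
divided by [sqrt 2], form an admissible pair of coefficients for the Euclidean
norm, and they turn [|a| + |b|] into a single inner product. *)
Lemma off_diagonal_le_euclidean :
  numerical_radius M <= Num.sqrt 2 / 2 * euclidean_opnorm A B.
Proof.
set c : R := Num.sqrt 2 / 2.
have c0 : 0 <= c by rewrite divr_ge0// sqrtr_ge0.
have c2 : c ^+ 2 = 2^-1 by rewrite expr_div_n sqr_sqrtr//; field.
have bound (a b : R[i]) := opnorm_le_euclidean K0 K0 AK BK (a := a) (b := b).
have e0 : 0 <= euclidean_opnorm A B.
  apply: le_trans (bound 0 0 _); last by rewrite !rnorm0 expr0n addr0.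
  apply: (@opnorm_ge0 _ _ _ (rnorm (0 : R[i]) * K + rnorm (0 : R[i]) * K)).
    by rewrite addr_ge0// mulr_ge0// rnorm_ge0.
  by apply: norm_boundD; apply: norm_boundZ.
apply: numerical_radius_le => [|u u1]; first exact: mulr_ge0.
rewrite inner_off_diagonal; set a := inner (A _) _; set b := inner (B _) _.
have [p p1 pE] := unit_phase a; have [q q1 qE] := unit_phase b.
have ab : rnorm (a + b^*%C) <= rnorm a + rnorm b.
  by apply: le_trans (rnormD _ _) _; rewrite {2}/rnorm normcJ.
apply: le_trans ab _.
pose l : R[i] := c%:C * p; pose m : R[i] := c%:C * q.
have lm : rnorm l ^+ 2 + rnorm m ^+ 2 <= 1.
  rewrite /l /m !rnormM p1 q1 !mulr1 rnorm_real ger0_norm// c2; lra.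
have lf : linear (l \*: A \+ m \*: B).
  by apply: linear_add; apply: linear_scale.
have fK : norm_bound (l \*: A \+ m \*: B) (rnorm l * K + rnorm m * K).
  by apply: norm_boundD; apply: norm_boundZ.
have lK0 : 0 <= rnorm l * K + rnorm m * K by rewrite addr_ge0// mulr_ge0// rnorm_ge0.
have fE := opnorm_norm_bound lf lK0 fK u.2.
have cab : c * (rnorm a + rnorm b) <= rnorm (l *: A u.2 + m *: B u.2) * rnorm u.1.
  apply: le_trans (cauchy_schwarz _ _); apply: le_trans (Re_le_rnorm _).
  apply: le_trans (ler_norm _).
  rewrite !innerE -/a -/b /l /m -!mulrA pE qE -mulrDr -!rmorphD -rmorphM.
  by rewrite mulrA.
have u12 : rnorm u.1 * rnorm u.2 <= 2^-1.
  have := rnorm_hsum u; rewrite u1; have := sqr_ge0 (rnorm u.1 - rnorm u.2).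
  rewrite sqrrB; lra.
have h : c * (rnorm a + rnorm b) <= euclidean_opnorm A B / 2.
  apply: le_trans cab _.
  apply: le_trans (ler_wpM2r (rnorm_ge0 _) fE) _.
  rewrite -mulrA [rnorm u.2 * _]mulrC; apply: ler_pM => //.
  - exact: opnorm_ge0 fK.
  - by rewrite mulr_ge0// rnorm_ge0.
  - exact: bound.
have -> : rnorm a + rnorm b = 2 * (c * (c * (rnorm a + rnorm b))).
  by rewrite [c * (c * _)]mulrA -expr2 c2; field.
by rewrite mulrC -ler_pdivlMr// -[leRHS]mulrA; apply: ler_wpM2l.
Qed.

End off_diagonal.

(** * Symmetric pairs and absolute values *)

Section symmetric_pair.
Variables (R : realType) (H : hilbertType R) (A B : H -> H).
Hypotheses (bA : bounded_operator A) (bB : bounded_operator B).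
Hypotheses (sA : symmetric_op A) (sB : symmetric_op B).

Local Notation W := (abs_operator A \+ 'i \*: abs_operator B).

Lemma abs_pair_linear : linear W.
Proof.
have /bounded_operatorP[lP _] := abs_operator_bounded bA sA.
have /bounded_operatorP[lQ _] := abs_operator_bounded bB sB.
by apply: linear_add => //; apply: linear_scale.
Qed.

Lemma abs_pair_bounded : exists K, norm_bound W K.
Proof.
have /bounded_operatorP[_ [K _ PK]] := abs_operator_bounded bA sA.
have /bounded_operatorP[_ [L _ QL]] := abs_operator_bounded bB sB.
by eexists; apply: norm_boundD PK _; apply: norm_boundZ QL.
Qed.

(** The forms of [|A|] and [|B|] are real, hence they are the real and imaginary
parts of the form of [|A| + i |B|]. *)
Lemma rnorm_inner_abs_pair x : rnorm (inner (W x) x) ^+ 2 =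
  rip (abs_operator A x) x ^+ 2 + rip (abs_operator B x) x ^+ 2.
Proof.
rewrite rnormC_sqr !innerE.
rewrite !symmetric_inner; try exact: abs_operator_symmetric.
by rewrite /= !(mul0r, mul1r, add0r, subr0, addr0, mulr0).
Qed.

(** [|l <A x, y> + m <B x, y>|^2] is at most [|<A x, y>|^2 + |<B x, y>|^2], and
by the mixed Schwarz inequality at most
[<|A| x, x> <|A| y, y> + <|B| x, x> <|B| y, y>], which is at most the product of
the moduli of the form of [|A| + i |B|] at [x] and [y]. *)
Lemma euclidean_le_abs : euclidean_opnorm A B <= numerical_radius W.
Proof.
have [K WK] := abs_pair_bounded.
have w0 := numerical_radius_ge0 WK; set w := numerical_radius W in w0 *.
have wW x : rip (abs_operator A x) x ^+ 2 + rip (abs_operator B x) x ^+ 2 <=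
    (w * rnorm x ^+ 2) ^+ 2.
  rewrite -rnorm_inner_abs_pair lerXn2r ?nnegrE ?mulr_ge0 ?exprn_ge0 ?rnorm_ge0//.
  exact: (inner_le_numerical_radius abs_pair_linear WK).
apply: euclidean_opnorm_le => a b ab; apply: opnorm_le => x x1.
apply: le_trans (_ : w * rnorm x <= w); last first.
  by rewrite -[leRHS]mulr1 ler_wpM2l.
apply: rnorm_le_inner => [|y]; first by rewrite mulr_ge0// rnorm_ge0.
set s := inner _ y.
have sE : s = a * inner (A x) y + b * inner (B x) y by rewrite /s !innerE.
have := mixed_schwarz bA sA x y; have := mixed_schwarz bB sB x y.
have := abs_operator_ge0 bA sA x; have := abs_operator_ge0 bA sA y.
have := abs_operator_ge0 bB sB x; have := abs_operator_ge0 bB sB y.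
have := wW x; have := wW y.
have : rnorm s <= rnorm a * rnorm (inner (A x) y) + rnorm b * rnorm (inner (B x) y).
  by rewrite sE -!rnormM rnormD.
move: (rnorm_ge0 a) (rnorm_ge0 b) (rnorm_ge0 (inner (A x) y))
  (rnorm_ge0 (inner (B x) y)) (rnorm_ge0 s) (rnorm_ge0 x) (rnorm_ge0 y) ab.
move: (rnorm a) (rnorm b) (rnorm (inner (A x) y)) (rnorm (inner (B x) y))
  (rnorm s) (rnorm x) (rnorm y) => l m p q t X Y.
move: (rip (abs_operator A x) x) (rip (abs_operator A y) y)
  (rip (abs_operator B x) x) (rip (abs_operator B y) y).
move=> Ax Ay Bx By l0 m0 p0 q0 t0 X0 Y0 lm tle wy wx By0 Bx0 Ay0 Ax0 qB pA.
have XY0 : 0 <= w * X * Y by rewrite !mulr_ge0.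
(* Two Schwarz inequalities in the plane: for the coefficients l, m, and for
   the quadratic forms at x and y. *)
have t2 : t ^+ 2 <= p ^+ 2 + q ^+ 2.
  apply: (@le_trans _ _ ((l * p + m * q) ^+ 2)).
    by rewrite lerXn2r ?nnegrE ?addr_ge0 ?mulr_ge0.
  have : (l * p + m * q) ^+ 2 + (l * q - m * p) ^+ 2 =
    (l ^+ 2 + m ^+ 2) * (p ^+ 2 + q ^+ 2) by ring.
  have : (l ^+ 2 + m ^+ 2) * (p ^+ 2 + q ^+ 2) <= 1 * (p ^+ 2 + q ^+ 2).
    by rewrite ler_wpM2r// addr_ge0// sqr_ge0.
  have := sqr_ge0 (l * q - m * p); lra.
have t2' : t ^+ 2 <= Ax * Ay + Bx * By by lra.
have t4 : (t ^+ 2) ^+ 2 <= ((w * X * Y) ^+ 2) ^+ 2.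
  apply: (@le_trans _ _ ((Ax * Ay + Bx * By) ^+ 2)).
    by rewrite lerXn2r ?nnegrE ?sqr_ge0 ?addr_ge0 ?mulr_ge0.
  apply: (@le_trans _ _ ((Ax ^+ 2 + Bx ^+ 2) * (Ay ^+ 2 + By ^+ 2))).
    rewrite -subr_ge0 [X in 0 <= X](_ : _ = (Ax * By - Bx * Ay) ^+ 2).
      exact: sqr_ge0.
    by ring.
  have -> : ((w * X * Y) ^+ 2) ^+ 2 = (w * X ^+ 2) ^+ 2 * (w * Y ^+ 2) ^+ 2 by ring.
  by rewrite ler_pM// addr_ge0// sqr_ge0.
by move: t4; rewrite !ler_pXn2r ?nnegrE ?sqr_ge0.
Qed.

(** On a unit vector [<|A| x, x>^2 <= || |A| x ||^2 = <A^2 x, x>]. *)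
Lemma abs_le_sqrt : numerical_radius W <= Num.sqrt (opnorm ((A \o A) \+ (B \o B))).
Proof.
have /bounded_operatorP[lA [K K0 AK]] := bA.
have /bounded_operatorP[lB [L L0 BL]] := bB.
apply: numerical_radius_le => [|x x1]; first exact: sqrtr_ge0.
rewrite -[leLHS](ger0_norm (rnorm_ge0 _)) -sqrtr_sqr; apply: ler_wsqrtr.
rewrite rnorm_inner_abs_pair.
have abs_le C : bounded_operator C -> symmetric_op C ->
    rip (abs_operator C x) x ^+ 2 <= rip (C (C x)) x.
  move=> bC sC; rewrite (rip_sym _ _ sC) ripxx -(rnorm_abs_operator bC sC).
  rewrite lerXn2r ?nnegrE ?rnorm_ge0 ?abs_operator_ge0//.
  apply: le_trans (ler_norm _) _; apply: le_trans (rip_cauchy_schwarz _ _) _.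
  by rewrite x1 mulr1.
apply: le_trans (lerD (abs_le _ bA sA) (abs_le _ bB sB)) _; rewrite -ripDl.
apply: le_trans (ler_norm _) _; apply: le_trans (rip_cauchy_schwarz _ _) _.
rewrite x1 mulr1.
have lC : linear ((A \o A) \+ (B \o B)) by apply: linear_add; apply: linear_comp.
have CK : norm_bound ((A \o A) \+ (B \o B)) (K * K + L * L).
  apply: norm_boundD => y.
    by apply: le_trans (AK _) _; rewrite -mulrA ler_wpM2l.
  by apply: le_trans (BL _) _; rewrite -mulrA ler_wpM2l.
have := opnorm_norm_bound lC _ CK x; rewrite x1 mulr1; apply.
by rewrite addr_ge0// mulr_ge0.
Qed.

Lemma opnorm_squares_le :
  opnorm ((A \o A) \+ (B \o B)) <= opnorm A ^+ 2 + opnorm B ^+ 2.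
Proof.
have /bounded_operatorP[lA [K K0 AK]] := bA.
have /bounded_operatorP[lB [L L0 BL]] := bB.
apply: opnorm_le => x x1.
apply: le_trans (rnormD _ _) _; apply: lerD; rewrite expr2.
- apply: le_trans (opnorm_norm_bound lA K0 AK _) _.
  rewrite ler_wpM2l ?(opnorm_ge0 K0 AK)//.
  apply: le_trans (opnorm_norm_bound lA K0 AK _) _.
  by rewrite -[leRHS]mulr1 ler_wpM2l// (opnorm_ge0 K0 AK).
- apply: le_trans (opnorm_norm_bound lB L0 BL _) _.
  rewrite ler_wpM2l ?(opnorm_ge0 L0 BL)//.
  apply: le_trans (opnorm_norm_bound lB L0 BL _) _.
  by rewrite -[leRHS]mulr1 ler_wpM2l// (opnorm_ge0 L0 BL).
Qed.

End symmetric_pair.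

(** * Real and imaginary parts *)

Section cartesian.
Variables (R : realType) (H : hilbertType R) (T : H -> H).
Hypothesis bT : bounded_operator T.

Local Notation A := (Re_operator T).
Local Notation B := (Im_operator T).

Lemma cartesian_bounded : bounded_operator A /\ bounded_operator B.
Proof.
have /bounded_operatorP[lT [K K0 TK]] := bT.
have lT' := adjoint_linear bT; have TK' := adjoint_norm_bound bT K0 TK.
have KK (a : R[i]) : 0 <= rnorm a * (K + K).
  by rewrite mulr_ge0 ?rnorm_ge0 ?addr_ge0.
split; apply/bounded_operatorP; split.
- by apply: linear_scale; apply: linear_add.
- by eexists; last by apply: norm_boundZ; apply: norm_boundD TK TK'.
- by apply: linear_scale; apply: linear_sub.
- eexists; last first.
    by apply: norm_boundZ; apply: norm_boundD TK _; apply: norm_boundN TK'.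
  exact: KK.
Qed.

Lemma inner_adjointl x y : inner (adjoint T x) y = inner x (T y).
Proof. by rewrite inner_conj -adjoint_spec// -inner_conj. Qed.

Lemma Re_symmetric : symmetric_op A.
Proof.
move=> x y; rewrite /Re_operator /= !innerE half_real conjc_real.
by rewrite inner_adjointl (adjoint_spec bT) addrC.
Qed.

Lemma Im_symmetric : symmetric_op B.
Proof.
move=> x y; rewrite /Im_operator /= !innerE.
rewrite inner_adjointl (adjoint_spec bT).
have -> : ((2 * 'i)^-1)^*%C = - (2 * 'i)^-1 :> R[i].
  rewrite conjc_inv rmorphM rmorph_nat /= -invrN -mulrN; congr (_ * _)^-1.
  by apply/eqP; rewrite eq_complex /= oppr0 !eqxx.
by rewrite mulNr -mulrN opprB.
Qed.

Lemma cartesianE x : T x = A x + 'i *: B x.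
Proof.
rewrite /Re_operator /Im_operator /= scalerA invfM mulrCA divff; last first.
  by rewrite eq_complex /= oner_eq0 andbF.
rewrite mulr1 -scalerDr addrACA subrr addr0 -mulr2n -(scaler_nat 2 (T x)).
by rewrite scalerA mulVf ?scale1r.
Qed.

(** The forms of the two parts are the real and imaginary parts of the form of
[T]. *)
Lemma cartesian_le_numerical_radius :
  opnorm A <= numerical_radius T /\ opnorm B <= numerical_radius T.
Proof.
have /bounded_operatorP[lT [K K0 TK]] := bT.
have [/bounded_operatorP[lA _] /bounded_operatorP[lB _]] := cartesian_bounded.
have w0 := numerical_radius_ge0 TK.
have inner_T x : inner (T x) x = (rip (A x) x +i* rip (B x) x).
  rewrite cartesianE innerDl (innerZl 'i) (symmetric_inner _ Re_symmetric).
  rewrite (symmetric_inner _ Im_symmetric).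
  by apply/eqP; rewrite eq_complex /=; apply/andP; split; apply/eqP; ring.
have le x : rip (A x) x ^+ 2 + rip (B x) x ^+ 2 <=
    (numerical_radius T * rnorm x ^+ 2) ^+ 2.
  have := inner_le_numerical_radius lT TK x.
  rewrite -(@ler_pXn2r _ 2) ?nnegrE ?mulr_ge0 ?exprn_ge0 ?rnorm_ge0//.
  by rewrite rnormC_sqr inner_T.
have bound C : linear C -> symmetric_op C ->
    (forall x, rip (C x) x ^+ 2 <= (numerical_radius T * rnorm x ^+ 2) ^+ 2) ->
    opnorm C <= numerical_radius T.
  move=> lC sC CT; apply: opnorm_le => x x1.
  apply: (@le_trans _ _ (numerical_radius T * rnorm x)); last first.
    by rewrite -[leRHS]mulr1 ler_wpM2l.
  apply: symmetric_norm => // y.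
  rewrite -(@ler_pXn2r _ 2) ?nnegrE ?mulr_ge0 ?exprn_ge0 ?rnorm_ge0//.
  by rewrite real_normK ?num_real.
split; apply: bound => //.
- exact: Re_symmetric.
- by move=> x; apply: le_trans (le x); rewrite lerDl sqr_ge0.
- exact: Im_symmetric.
- by move=> x; apply: le_trans (le x); rewrite lerDr sqr_ge0.
Qed.

End cartesian.

Local Close Scope complex_scope.
Local Close Scope classical_set_scope.

(** * The chain of inequalities *)

Theorem mainTheorem9 (R : realType) (H : hilbertType R) (T : H -> H)
    (boundedT : bounded_operator T) :
  let ReT := Re_operator T in
  let ImT := Im_operator T in
  let c : R := Num.sqrt 2 / 2 in
  2^-1 * opnorm T <= numerical_radius (block_operator \0 ReT ImT \0)
  /\ numerical_radius (block_operator \0 ReT ImT \0)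
       <= c * euclidean_opnorm ReT ImT
  /\ c * euclidean_opnorm ReT ImT
       <= c * numerical_radius (abs_operator ReT \+ 'i \*: abs_operator ImT)
  /\ c * numerical_radius (abs_operator ReT \+ 'i \*: abs_operator ImT)
       <= c * Num.sqrt (opnorm ((ReT \o ReT) \+ (ImT \o ImT)))
  /\ c * Num.sqrt (opnorm ((ReT \o ReT) \+ (ImT \o ImT)))
       <= c * Num.sqrt (opnorm ReT ^+ 2 + opnorm ImT ^+ 2)
  /\ c * Num.sqrt (opnorm ReT ^+ 2 + opnorm ImT ^+ 2)
       <= numerical_radius T.
Proof.
move=> ReT ImT c.
have [bA bB] := cartesian_bounded boundedT.
have sA : symmetric_op ReT := Re_symmetric boundedT.
have sB : symmetric_op ImT := Im_symmetric boundedT.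
have c0 : 0 <= c by rewrite divr_ge0// sqrtr_ge0.
have /bounded_operatorP[lA [K K0 AK]] := bA.
have /bounded_operatorP[lB [L L0 BL]] := bB.
have KL0 : 0 <= K + L by rewrite addr_ge0.
have AKL : norm_bound ReT (K + L).
  by move=> x; apply: le_trans (AK x) _; rewrite ler_wpM2r ?rnorm_ge0// lerDl.
have BKL : norm_bound ImT (K + L).
  by move=> x; apply: le_trans (BL x) _; rewrite ler_wpM2r ?rnorm_ge0// lerDr.
(* The imaginary unit of a numerically closed field is the complex number i. *)
rewrite -complexiE; do 5?split.
- rewrite ler_pdivrMl//; apply: opnorm_le => x x1.
  by rewrite (cartesianE T x); apply: (rnorm_le_off_diagonal lA lB KL0 AKL BKL).
- exact: (off_diagonal_le_euclidean lA lB KL0 AKL BKL).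
- by rewrite ler_wpM2l//; apply: euclidean_le_abs.
- by rewrite ler_wpM2l//; apply: abs_le_sqrt.
- by rewrite ler_wpM2l//; apply: ler_wsqrtr; apply: opnorm_squares_le.
have [Aw Bw] := cartesian_le_numerical_radius boundedT.
set w := numerical_radius T in Aw Bw *.
have A0 := opnorm_ge0 K0 AK; have B0 := opnorm_ge0 L0 BL.
have w0 : 0 <= w := le_trans A0 Aw.
rewrite -(ler_pXn2r (n := 2))// ?nnegrE ?mulr_ge0 ?sqrtr_ge0//.
rewrite exprMn sqr_sqrtr ?addr_ge0 ?sqr_ge0//.
have -> : c ^+ 2 = 2^-1 by rewrite expr_div_n sqr_sqrtr//; field.
have : opnorm ReT ^+ 2 <= w ^+ 2 by rewrite lerXn2r.
have : opnorm ImT ^+ 2 <= w ^+ 2 by rewrite lerXn2r.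
lra.
Qed.
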